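(* Let $G$ be a finite group with a split $BN$-pair of characteristic $p$ satisfying the commutator relations, and let $K$ be an algebraically closed field of characteristic $\ell\ge0$ with $\ell\neq p$. Let $L_0$ be a Levi subgroup of $G$ and let $M_0$ be an irreducible cuspidal $KL_0$-module. Suppose that $L$ is a Levi subgroup of $G$ with $L_0\le L$ and $W_G(L_0,M_0)=W_L(L_0,M_0)$. Then $R_L^G(M_1)$ is irreducible for every irreducible quotient or submodule $M_1$ of $R_{L_0}^L(M_0)$.
   Context: A parabolic (resp. Levi) subgroup of $G$ is an $N$-conjugate of a standard parabolic (resp. standard Levi) subgroup, where $N$ is the subgroup given by the $BN$-pair. $R_L^G$ denotes Harish-Chandra induction: $R_L^G(M)=\mathrm{Ind}_P^G(\tilde M)$ with $P$ a parabolic subgroup with Levi complement $L$ and $\tilde M$ the inflation of the $KL$-module $M$ to $P$ (independent of $P$ up to isomorphism). For an irreducible cuspidal $KL_0$-module $M_0$, the ramification group is $W_G(L_0,M_0):=(N_G(L_0,M_0)\cap N)L_0/L_0$, where $N_G(L_0,M_0)$ is the stabilizer in $N_G(L_0)$ of the isomorphism class of $M_0$; $W_L(L_0,M_0)$ is the analogous group for $L$, viewed as a subgroup of $W_G(L_0,M_0)$. *)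

(* Defs.v *)
From HB Require Import structures.
From mathcomp Require Import all_boot all_order all_algebra.
From mathcomp Require Import all_fingroup all_solvable mxrepresentation.
From mathcomp Require Import boolp reals.

Set Implicit Arguments.
Unset Strict Implicit.
Unset Printing Implicit Defensive.

Import GroupScope GRing.Theory.
Local Open Scope group_scope.

(* Modules are row spaces, so groups act on the right: a w stands for the root
   a *m rho w, and X ^ n, with x ^ n = n^-1 x n, for conjugates. *)

Record BN_pair (gT : finGroupType) (G B N H : {group gT})
    (S : {set coset_of H}) : Prop := {
  BN_gen : <<B :|: N>> = G;
  BN_cap : B :&: N = H;
  BN_normal : H <| N;
  BN_simple_gen : <<S>> = N / H;
  BN_simple_order : {in S, forall s, #[s] = 2};
  BN_mul : {in N &, forall n m, coset H n \in S ->
    n *: B :* m \subset (B :* (n * m)) * B :|: (B :* m) * B};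
  BN_conj : {in N, forall n, coset H n \in S -> B :^ n != B} }.

Record split_BN_pair (gT : finGroupType) (p : nat) (G : {group gT}) := {
  bnB : {group gT};
  bnN : {group gT};
  bnU : {group gT};
  bnH : {group gT};
  bnS : {set coset_of bnH};
  bn_prime : prime p;
  bn_pair : BN_pair G bnB bnN bnS;
  bn_split : bnU ><| bnH = bnB;
  bn_pgroup : p.-group bnU;
  bn_p'group : p^'.-group bnH;
  bn_abelian : abelian bnH;
  bn_saturated : \bigcap_(n in bnN) bnB :^ n = bnH }.

Definition weyl_group gT p (G : {group gT}) (D : split_BN_pair p G) :
  {group coset_of (bnH D)} := (bnN D / bnH D)%G.

Definition rv_dot (R : realType) r (u v : 'rV[R]_r) : R := (u *m v^T)%R 0%R 0%R.

Definition nonneg_comb (R : realType) (I : finType) (S : {set I}) r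
    (a : I -> 'rV[R]_r) (v : 'rV[R]_r) : Prop :=
  exists c : I -> R,
    (forall s, (0 <= c s)%R) /\ v = (\sum_(s in S) c s *: a s)%R.

(* The root system of the Weyl group W, realized as a finite reflection group
   in the Euclidean space R^r: all roots have length 1, [rs_simple s] (s in S)
   is the simple root of s, and the roots are the vectors
   [rs_simple s *m rs_repr w] with s in S and w in W. *)
Record root_system (R : realType) gT p (G : {group gT})
    (D : split_BN_pair p G) := {
  rs_rank : nat;
  rs_repr : mx_representation R (weyl_group D) rs_rank;
  rs_simple : coset_of (bnH D) -> 'rV[R]_rs_rank;
  rs_faithful : mx_faithful rs_repr;
  rs_unit : {in bnS D, forall s, rv_dot (rs_simple s) (rs_simple s) = 1%R};
  rs_free : forall c : coset_of (bnH D) -> R,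
    (\sum_(s in bnS D) c s *: rs_simple s = 0)%R ->
    {in bnS D, forall s, c s = 0%R};
  rs_reflection : {in bnS D, forall s v,
    (v *m rs_repr s = v - (2 * rv_dot v (rs_simple s)) *: rs_simple s)%R};
  rs_sign : {in bnS D & weyl_group D, forall s w,
    let a := (rs_simple s *m rs_repr w)%R in
    nonneg_comb (bnS D) rs_simple a \/ nonneg_comb (bnS D) rs_simple (- a)%R} }.

Section RootSubgroups.

Variables (R : realType) (gT : finGroupType) (p : nat) (G : {group gT}).
Variables (D : split_BN_pair p G) (Phi : root_system R D).

Local Notation B := (bnB D).
Local Notation N := (bnN D).
Local Notation U := (bnU D).
Local Notation H := (bnH D).
Local Notation S := (bnS D).

Definition root_at (s : coset_of H) (n : gT) : 'rV[R]_(rs_rank Phi) :=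
  (rs_simple Phi s *m rs_repr Phi (coset H n))%R.

(* n represents the longest element w0 of W *)
Definition longest_rep (n : gT) : bool :=
  (n \in N) &&
  [forall s in S, `[< nonneg_comb S (rs_simple Phi) (- root_at s n)%R >]].

Definition w0_rep : gT := odflt 1 [pick n | longest_rep n].

(* The root subgroup of the simple root of s: the intersection of U with the
   s-conjugate of the opposite of U. *)
Definition simple_root_subgroup (s : coset_of H) : {set gT} :=
  U :&: U :^ (w0_rep * repr s).

(* The root subgroup of [root_at s n]; (X_a)^n = X_(a w) for w = coset H n. *)
Definition root_subgroup (s : coset_of H) (n : gT) : {set gT} :=
  simple_root_subgroup s :^ n.

Definition positive_comb r (a b c : 'rV[R]_r) : Prop :=
  exists x y : R, [/\ (0 < x)%R, (0 < y)%R & c = (x *: a + y *: b)%R].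

(* [X_a, X_b] <= < X_c | c a root, c = x a + y b with x, y > 0 > for linearly
   independent roots a, b. The coefficients are real since W need not be
   crystallographic and roots are normalized. *)
Definition commutator_relations : Prop :=
  {in S & N, forall s n, {in S & N, forall t m,
    root_at s n <> root_at t m -> root_at s n <> (- root_at t m)%R ->
    [~: root_subgroup s n, root_subgroup t m] \subset
    << \bigcup_(u in S)
         \bigcup_(k in N | `[< positive_comb (root_at s n) (root_at t m)
                                             (root_at u k) >])
           root_subgroup u k >> }}.

(* N_J, the inverse image of W_J = <J> in N. The groups B, N are arguments
   because these notions are also needed for the BN-pair of a Levi subgroup. *)
Definition N_sub (N' : {set gT}) (J : {set coset_of H}) : {set gT} :=
  [set n in N' | coset H n \in <<J>>].

Definition std_parabolic_of (B' N' : {set gT}) (J : {set coset_of H}) :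
  {set gT} := B' * N_sub N' J * B'.

Definition std_parabolic (J : {set coset_of H}) : {set gT} :=
  std_parabolic_of B N J.

Definition std_levi (J : {set coset_of H}) : {set gT} :=
  << H :|: \bigcup_(s in J) \bigcup_(n in N_sub N J) root_subgroup s n >>.

Definition is_parabolic (P : {set gT}) : Prop :=
  exists (J : {set coset_of H}) n, [/\ J \subset S, n \in N & P = std_parabolic J :^ n].

Definition is_levi (L : {set gT}) : Prop :=
  exists (J : {set coset_of H}) n, [/\ J \subset S, n \in N & L = std_levi J :^ n].

(* Q is a parabolic subgroup of the Levi subgroup L = (L_J)^n with respect to
   its BN-pair ((B^n) :&: L, N :&: L), whose simple reflections are J^n. *)
Definition is_parabolic_in (L Q : {set gT}) : Prop :=
  exists (J : {set coset_of H}) n, [/\ J \subset S, n \in N, L = std_levi J :^ n &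
    exists (I : {set coset_of H}) m, [/\ I \subset J :^ coset H n, m \in N :&: L &
      Q = std_parabolic_of (B :^ n :&: L) (N :&: L) I :^ m]].

End RootSubgroups.

Section Induction.

Variables (K : fieldType) (gT : finGroupType) (P G : {group gT}) (n : nat).
Hypothesis sPG : P \subset G.
Variable rP : mx_representation K P n.

Definition rcoset_rep (i : 'I_#|rcosets P G|) : gT := repr (enum_val i).

(* Ind_P^G M = M (x)_KP KG = \bigoplus_i M (x) t_i, where the t_i represent the
   right cosets of P in G, and (v (x) t_i) x = v (t_i x t_j^-1) (x) t_j if
   P t_i x = P t_j. *)
Definition ind_mx (x : gT) : 'M[K]_(\sum_(i < #|rcosets P G|) n) :=
  \mxblock_(i < #|rcosets P G|, j < #|rcosets P G|)
    (if rcoset_rep i * x * (rcoset_rep j)^-1 \in P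
     then rP (rcoset_rep i * x * (rcoset_rep j)^-1) else 0%R : 'M[K]_n).

Lemma rcoset_rep_in i : rcoset_rep i \in G.
Proof.
rewrite /rcoset_rep; have /rcosetsP[x Gx ->] := enum_valP i.
have /rcosetP[y Py ->] := mem_repr_rcoset P x.
by rewrite groupM // (subsetP sPG).
Qed.

Lemma rcoset_repK i : P :* rcoset_rep i = enum_val i.
Proof.
rewrite /rcoset_rep; have /rcosetsP[x Gx ->] := enum_valP i.
exact: rcoset_repr.
Qed.

Lemma rcoset_rep_exists x : x \in G ->
  exists i, forall j, (x * (rcoset_rep j)^-1 \in P) = (j == i).
Proof.
move=> Gx; have Cx : P :* x \in rcosets P G by apply/rcosetsP; exists x.
exists (enum_rank_in Cx (P :* x)) => j.
rewrite -mem_rcoset -(inj_eq enum_val_inj) (enum_rankK_in Cx) // -rcoset_repK.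
by apply/rcoset_eqP/eqP => ->.
Qed.

Lemma ind_mx_repr : mx_repr G ind_mx.
Proof.
split=> [|x y Gx Gy]; last first.
  apply/esym; etransitivity; first exact: mul_mxblock.
  apply: eq_mxblock => i j.
  have [k kP] := rcoset_rep_exists (groupM (rcoset_rep_in i) Gx).
  rewrite (bigD1 k) //= big1 ?addr0 => [|l /negPf lk]; last first.
    by rewrite kP lk mul0mx.
  have Pk : rcoset_rep i * x * (rcoset_rep k)^-1 \in P by rewrite kP.
  have def_xy : rcoset_rep i * (x * y) * (rcoset_rep j)^-1 =
    (rcoset_rep i * x * (rcoset_rep k)^-1)
      * (rcoset_rep k * y * (rcoset_rep j)^-1) by rewrite !mulgA mulgKV.
  rewrite Pk def_xy (groupMl _ Pk).
  case Pj: (rcoset_rep k * y * _ \in P); last by rewrite mulmx0.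
  by rewrite -repr_mxM.
rewrite -[RHS]mxdiagZ; apply: eq_mxblock => i j.
have [k kP] := rcoset_rep_exists (rcoset_rep_in i).
have def_k : i = k by apply/eqP; rewrite -kP mulgV group1.
rewrite mulg1 kP -def_k eq_sym; case: eqVneq => [<- | neq_ij].
  by rewrite mulgV repr_mx1 conform_mx_id.
by [].
Qed.

Definition ind_repr := MxRepresentation ind_mx_repr.

End Induction.

Section Inflation.

Variables (K : fieldType) (gT : finGroupType) (U L P : {group gT}) (n : nat).
Hypothesis sdP : U ><| L = P.
Variable rL : mx_representation K L n.

Definition infl_mx (x : gT) : 'M[K]_n := rL (remgr U L x).

Lemma infl_mx_repr : mx_repr P infl_mx.
Proof.
have [nsUP _ defP _ tiUL] := sdprod_context sdP.
have cL : L \in [complements to U in P] by apply/complP; split.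
have memL x : x \in P -> remgr U L x \in L by rewrite -defP; apply: mem_remgr.
split=> [|x y Px Py]; first by rewrite /infl_mx remgr1 ?group1 // repr_mx1.
by rewrite /infl_mx (remgrM cL) // repr_mxM ?memL.
Qed.

Definition infl_repr := MxRepresentation infl_mx_repr.

End Inflation.

(* R_L^G(M) = Ind_P^G of the inflation of M to P. The unipotent radical of the
   parabolic subgroup P is O_p(P). *)
Definition HC_ind (K : fieldType) (gT : finGroupType) (p : nat)
    (G P L : {group gT}) (sPG : P \subset G) (sdP : 'O_p(P) ><| L = P)
    (n : nat) (rL : mx_representation K L n) :=
  ind_repr sPG (infl_repr sdP rL).

(* M is cuspidal if its Harish-Chandra restriction, the space of O_p(Q)-fixed
   points, is 0 for every proper parabolic subgroup Q of L. *)
Definition cuspidal (R : realType) gT p (G : {group gT})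
    (D : split_BN_pair p G) (Phi : root_system R D)
    (K : fieldType) (L : {group gT}) n (rL : mx_representation K L n) : Prop :=
  forall Q : {group gT}, is_parabolic_in Phi L Q -> Q \proper L ->
    rfix_mx rL 'O_p(Q) = 0%R.

Section Ramification.

Variables (K : fieldType) (gT : finGroupType) (L : {group gT}) (n : nat).
Variable rL : mx_representation K L n.

Definition twist_mx (x y : gT) : 'M[K]_n := rL (y ^ x^-1).

Lemma twist_mx_repr x : x \in 'N(L) -> mx_repr L (twist_mx x).
Proof.
move=> nLx; split=> [|y z Ly Lz]; first by rewrite /twist_mx conj1g repr_mx1.
by rewrite /twist_mx conjMg repr_mxM ?memJ_norm ?groupV.
Qed.

Definition twist_repr x (nLx : x \in 'N(L)) :=
  MxRepresentation (twist_mx_repr nLx).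

(* N_G(L, M), the stabilizer in N_G(L) of the isomorphism class of M *)
Definition iso_stab (G : {set gT}) : {set gT} :=
  [set x in 'N_G(L) |
     `[< exists nLx : x \in 'N(L), mx_rsim (twist_repr nLx) rL >]].

Definition ram_group (G N : {set gT}) : {set coset_of L} :=
  (iso_stab G :&: N) * L / L.

End Ramification.

Definition sub_or_quotient (K : fieldType) (gT : finGroupType) (G : {group gT})
    n m (rM : mx_representation K G n) (rX : mx_representation K G m) : Prop :=
  exists (V : 'M[K]_m) (modV : mxmodule rX V),
    mx_rsim rM (submod_repr modV) \/ mx_rsim rM (factmod_repr modV).

(* Main.v *)
Require Import Defs.
From HB Require Import structures.
From mathcomp Require Import all_boot all_order all_algebra.
From mathcomp Require Import all_fingroup all_solvable mxrepresentation.
From mathcomp Require Import boolp reals.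
From mathcomp Require Import ring.

(* Suppose first that M1 is a submodule of R_{L0}^L(M0), and let U be a nonzero
   proper submodule of X = R_L^G(M1). Frobenius reciprocity gives a nonzero
   Q-homomorphism pi : M1 -> M0. Put V = O_p(P) O_p(Q). Viewing elements of X as
   functions f on G with values in M1, each n in N gives a map
   theta_n : f |-> pi (f n) on the V-fixed points of X. If n does not normalize
   L0, some proper parabolic subgroup Q1 of L0 satisfies O_p(Q1) <= V^n, and
   theta_n vanishes because M0 is cuspidal. Otherwise theta_n is an
   L0-homomorphism to the twist of M0 by n. On the V-fixed points of U the maps
   theta_n with n outside P are jointly injective, because G = V L0 N V L0 and U
   contains no nonzero function supported on P, whereas theta_1 is nonzero there.
   Hence M0 is isomorphic to its twist by some n outside P, contrary to the
   hypothesis on the ramification groups. Quotients of R_{L0}^L(M0) are reduced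
   to submodules by passing to contragredient modules.

   For the group theory, a vector l of the reflection representation determines
   the groups Uv l, Lv l and Pv l generated (with H for the last two) by the root
   subgroups of the roots with positive, zero and nonnegative scalar product with
   l. The Levi and parabolic subgroups are exactly the groups Lv l and Pv l, and a
   parabolic subgroup of Lv m is Pv t :&: Lv m for a small perturbation t of m.
   The key point is that Lv l has no nontrivial normal p-subgroup: such a subgroup
   would lie in two opposite conjugates of bnU D. *)

Set Implicit Arguments.
Unset Strict Implicit.
Unset Printing Implicit Defensive.

Import GroupScope GRing.Theory.
Import Order.TTheory Num.Theory.
Local Open Scope group_scope.

(** * Bilinearity of the scalar product *)

Section RvDot.

Variables (R : realType) (r : nat).
Implicit Types u v w : 'rV[R]_r.

Lemma rv_dotC u v : rv_dot u v = rv_dot v u.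
Proof.
rewrite /rv_dot !mxE; apply: eq_bigr => i _.
by rewrite !mxE mulrC.
Qed.

Lemma rv_dotDl u v w : rv_dot (u + v)%R w = (rv_dot u w + rv_dot v w)%R.
Proof. by rewrite /rv_dot mulmxDl mxE. Qed.

Lemma rv_dotZl (c : R) u v : rv_dot (c *: u)%R v = (c * rv_dot u v)%R.
Proof. by rewrite /rv_dot -scalemxAl mxE. Qed.

Lemma rv_dotNl u v : rv_dot (- u)%R v = (- rv_dot u v)%R.
Proof. by rewrite /rv_dot mulNmx mxE. Qed.

Lemma rv_dotBl u v w : rv_dot (u - v)%R w = (rv_dot u w - rv_dot v w)%R.
Proof. by rewrite rv_dotDl rv_dotNl. Qed.

Lemma rv_dotDr u v w : rv_dot w (u + v)%R = (rv_dot w u + rv_dot w v)%R.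
Proof. by rewrite rv_dotC rv_dotDl !(rv_dotC w). Qed.

Lemma rv_dotZr (c : R) u v : rv_dot u (c *: v)%R = (c * rv_dot u v)%R.
Proof. by rewrite rv_dotC rv_dotZl rv_dotC. Qed.

Lemma rv_dotNr u v : rv_dot u (- v)%R = (- rv_dot u v)%R.
Proof. by rewrite rv_dotC rv_dotNl rv_dotC. Qed.

Lemma rv_dotBr u v w : rv_dot w (u - v)%R = (rv_dot w u - rv_dot w v)%R.
Proof. by rewrite rv_dotDr rv_dotNr. Qed.

Lemma rv_dot_suml (I : finType) (P : pred I) (F : I -> 'rV[R]_r) v :
  rv_dot (\sum_(i | P i) F i)%R v = (\sum_(i | P i) rv_dot (F i) v)%R.
Proof. by rewrite /rv_dot mulmx_suml summxE. Qed.

Lemma rv_dot0l v : rv_dot 0%R v = 0%R.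
Proof. by rewrite /rv_dot mul0mx mxE. Qed.

End RvDot.

Lemma gen_mull_ind (gT : finGroupType) (A : {set gT}) (P : gT -> Prop) :
  P 1 -> (forall x y, x \in A -> y \in <<A>> -> P y -> P (x * y)) ->
  {in <<A>>, forall y, P y}.
Proof.
move=> P1 PM y /gen_prodgP[n [c cA ->{y}]].
elim: n c cA => [|n IHn] c cA; first by rewrite big_ord0.
rewrite big_ord_recl; apply: PM => //; last by apply: IHn => i; apply: cA.
by apply: group_prod => i _; apply/mem_gen/cA.
Qed.

(** * Roots, lengths and the exchange condition in the Weyl group *)

Section WeylGroup.

Variables (R : realType) (gT : finGroupType) (p : nat) (G : {group gT}).
Variables (D : split_BN_pair p G) (Phi : root_system R D).

Local Notation N := (bnN D).
Local Notation H := (bnH D).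
Local Notation S := (bnS D).
Local Notation W := (weyl_group D).
Local Notation rho := (rs_repr Phi).
Local Notation alpha := (rs_simple Phi).
Local Notation vec := 'rV[R]_(rs_rank Phi).
Local Notation "v ** w" := (mulmx v (rho w%g))
  (at level 40, left associativity) : ring_scope.

Lemma simple_in_W : {subset S <= W}.
Proof.
move=> s Ss; rewrite /weyl_group /= -(BN_simple_gen (bn_pair D)).
exact: mem_gen.
Qed.

Lemma simple_mul_self s : s \in S -> s * s = 1.
Proof.
move=> Ss; have := BN_simple_order (bn_pair D) Ss => os.
by rewrite -expg2 -os expg_order.
Qed.

Lemma simpleV s : s \in S -> s^-1 = s.
Proof. by move=> /simple_mul_self s2; apply: (mulgI s); rewrite mulgV s2. Qed.

Lemma W_ind (P : coset_of H -> Prop) :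
  P 1 -> (forall s w, s \in S -> w \in W -> P w -> P (s * w)) ->
  {in W, forall w, P w}.
Proof.
rewrite /weyl_group /= -(BN_simple_gen (bn_pair D)) => P1 PS.
exact: gen_mull_ind.
Qed.

Lemma act_mul (v : vec) w w' : w \in W -> w' \in W ->
  (v ** (w * w') = v ** w ** w')%R.
Proof. by move=> Ww Ww'; rewrite -mulmxA repr_mxM. Qed.

Lemma act_K (v : vec) w : w \in W -> (v ** w ** w^-1 = v)%R.
Proof. by move=> Ww; rewrite -act_mul ?groupV // mulgV repr_mx1 mulmx1. Qed.

Lemma act_KV (v : vec) w : w \in W -> (v ** w^-1 ** w = v)%R.
Proof. by move=> Ww; rewrite -act_mul ?groupV // mulVg repr_mx1 mulmx1. Qed.

Lemma simple_reflects s : s \in S -> (alpha s ** s = - alpha s)%R.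
Proof.
move=> Ss; rewrite rs_reflection // rs_unit // mulr1 scaler_nat mulr2n.
by rewrite opprD addrA subrr sub0r.
Qed.

Lemma dot_act w (u v : vec) : w \in W ->
  rv_dot (u ** w)%R (v ** w)%R = rv_dot u v.
Proof.
move=> Ww; move: w Ww u v.
apply: W_ind => [|s w Ss Ww IH] u v; first by rewrite repr_mx1 !mulmx1.
rewrite !act_mul ?(simple_in_W Ss) // IH !rs_reflection //.
rewrite !(rv_dotBl, rv_dotBr, rv_dotZl, rv_dotZr) rs_unit //.
rewrite !(rv_dotC (alpha s)); ring.
Qed.

Lemma dot_actl w (u v : vec) : w \in W ->
  rv_dot (u ** w)%R v = rv_dot u (v ** w^-1)%R.
Proof. by move=> Ww; rewrite -{1}(act_KV v Ww) dot_act. Qed.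

(** By [rs_free] the matrix with the simple roots as rows has a right inverse, which turns any
    column of prescribed scalar products into a vector. *)
Lemma dual_vector (c : coset_of H -> R) :
  exists l : vec, {in S, forall s, rv_dot (alpha s) l = c s}.
Proof.
pose A : 'M[R]_(#|S|, rs_rank Phi) := (\matrix_(i < #|S|) alpha (enum_val i))%R.
have : row_free A.
  apply: inj_row_free => v vA0.
  pose d (s : coset_of H) : R :=
    (\sum_(i < #|S|) if enum_val i == s then v 0 i else 0)%R.
  have dE i : d (enum_val i) = v 0%R i.
    rewrite /d (bigD1 i) //= eqxx big1 ?addr0 // => j /negPf ji.
    by rewrite (inj_eq enum_val_inj) ji.
  have d0 : {in S, forall s, d s = 0%R}.
    apply: (rs_free (r := Phi)); rewrite -[RHS]vA0 mulmx_sum_row big_enum_val.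
    by apply: eq_bigr => i _; rewrite dE rowK.
  by apply/rowP=> i; rewrite -dE d0 ?enum_valP // mxE.
case/row_freeP=> B AB1.
pose cv : 'cV[R]_(#|S|) := (\col_i c (enum_val i))%R.
exists ((B *m cv)^T)%R => s Ss; rewrite /rv_dot trmxK.
set i := enum_rank_in Ss s.
have As : row i A = alpha s by rewrite rowK enum_rankK_in.
have := congr1 (fun M => (M *m cv)%R i 0%R) AB1.
rewrite /= mul1mx -mulmxA [in RHS]mxE enum_rankK_in // => <-.
by rewrite -As -row_mul mxE.
Qed.

(** The scalar product of a root with this vector is its height, the sum of its coefficients on the
    simple roots; the sign tells positive roots from negative ones. *)
Definition height_vec : vec := sval (cid (dual_vector (fun=> 1%R))).
Local Notation hv := height_vec.

Lemma dot_height s : s \in S -> rv_dot (alpha s) hv = 1%R.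
Proof. by rewrite /height_vec; case: cid => l /= lP /lP. Qed.

Definition is_root (a : vec) : Prop :=
  exists s w, [/\ s \in S, w \in W & a = (alpha s ** w)%R].

Lemma root_simple s : s \in S -> is_root (alpha s).
Proof. by move=> Ss; exists s, 1; rewrite repr_mx1 mulmx1 group1. Qed.

Lemma root_act a w : w \in W -> is_root a -> is_root (a ** w)%R.
Proof.
move=> Ww [s [v [Ss Wv ->]]]; exists s, (v * w).
by rewrite groupM ?act_mul.
Qed.

Lemma root_opp a : is_root a -> is_root (- a)%R.
Proof.
move=> [s [v [Ss Wv ->]]]; have Ws := simple_in_W Ss; exists s, (s * v).
by rewrite groupM // act_mul // simple_reflects // mulNmx.
Qed.

Lemma root_at_root s n : s \in S -> n \in N -> is_root (root_at Phi s n).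
Proof. by move=> Ss Nn; exists s, (coset H n); rewrite mem_quotient. Qed.

Lemma root_unit a : is_root a -> rv_dot a a = 1%R.
Proof. by move=> [s [v [Ss Wv ->]]]; rewrite dot_act // rs_unit. Qed.

Lemma root_sign a : is_root a ->
  nonneg_comb S alpha a \/ nonneg_comb S alpha (- a)%R.
Proof. by move=> [s [v [Ss Wv ->]]]; apply: rs_sign. Qed.

Lemma nonneg_dot a (l : vec) : nonneg_comb S alpha a ->
  {in S, forall s, (0 <= rv_dot (alpha s) l)%R} -> (0 <= rv_dot a l)%R.
Proof.
move=> [c [c0 ->]] l0; rewrite rv_dot_suml; apply: sumr_ge0 => s Ss.
by rewrite rv_dotZl mulr_ge0 ?l0.
Qed.

Lemma nonneg_dot_eq0 a (l : vec) (c : coset_of H -> R) :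
    (forall s, (0 <= c s)%R) -> a = (\sum_(s in S) c s *: alpha s)%R ->
    {in S, forall s, (0 <= rv_dot (alpha s) l)%R} -> rv_dot a l = 0%R ->
  {in S, forall s, rv_dot (alpha s) l != 0%R -> c s = 0%R}.
Proof.
move=> c0 -> l0; rewrite rv_dot_suml => /eqP.
rewrite psumr_eq0 => [/allP al s Ss ls|s Ss]; last first.
  by rewrite rv_dotZl mulr_ge0 ?l0.
have /implyP/(_ Ss) := al s (mem_index_enum s).
by rewrite rv_dotZl mulf_eq0 (negPf ls) orbF => /eqP.
Qed.

(** Height zero would make every coefficient vanish, whereas roots have length 1. *)
Lemma nonneg_height a : is_root a -> nonneg_comb S alpha a ->
  (0 < rv_dot a hv)%R.
Proof.
move=> ra na; rewrite lt_neqAle nonneg_dot ?andbT //; last first.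
  by move=> s Ss; rewrite dot_height ?ler01.
apply/eqP=> /esym a0; case: na => c [c0 ac].
have c00 : {in S, forall s, c s = 0%R}.
  move=> s Ss; apply: (nonneg_dot_eq0 c0 ac _ a0) => // [t St|].
    by rewrite dot_height ?ler01.
  by rewrite dot_height ?oner_neq0.
have := root_unit ra; rewrite {1}ac big1 ?rv_dot0l => [/esym/eqP|s Ss].
  by rewrite oner_eq0.
by rewrite c00 ?scale0r.
Qed.

Lemma height_neq0 a : is_root a -> rv_dot a hv != 0%R.
Proof.
move=> ra; case: (root_sign ra) => [/(nonneg_height ra)|].
  by move/gt_eqF->.
move/(nonneg_height (root_opp ra)); rewrite rv_dotNl oppr_gt0.
by move/lt_eqF->.
Qed.

Lemma height_pos a : is_root a -> (0 < rv_dot a hv)%R -> nonneg_comb S alpha a.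
Proof.
move=> ra a0; case: (root_sign ra) => // /(nonneg_height (root_opp ra)).
by rewrite rv_dotNl oppr_gt0 ltNge (ltW a0).
Qed.

Lemma height_leNlt a : is_root a -> (rv_dot a hv < 0)%R = ~~ (0 < rv_dot a hv)%R.
Proof. by move=> ra; rewrite -leNgt le_eqVlt (negPf (height_neq0 ra)). Qed.

Lemma sum_delta s (x : R) : s \in S ->
  (x *: alpha s = \sum_(t in S) (if t == s then x else 0) *: alpha t)%R.
Proof.
move=> Ss; rewrite (bigD1 s) //= eqxx big1 ?addr0 // => t /andP[_ /negPf->].
by rewrite scale0r.
Qed.

(** A simple reflection permutes the positive roots other than its own: [a] and the negative of its
    image are both nonnegative combinations and their sum is a multiple of [alpha s], so [a] is
    itself such a multiple, and comparing lengths gives the factor 1. *)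
Lemma sign_change a s : is_root a -> s \in S -> (0 < rv_dot a hv)%R ->
  (rv_dot (a ** s)%R hv < 0)%R -> a = alpha s.
Proof.
move=> ra Ss a0 as0; have [c [c0 ac]] := height_pos ra a0.
have rb := root_opp (root_act (simple_in_W Ss) ra).
have [|d [d0 bd]] := height_pos rb; first by rewrite rv_dotNl oppr_gt0.
pose k := (2 * rv_dot a (alpha s))%R.
have e0 : {in S, forall t, c t + d t - (if t == s then k else 0) = 0}%R.
  apply: (rs_free (r := Phi)); under eq_bigr do rewrite scalerBl scalerDl.
  rewrite sumrB big_split /= -ac -bd -sum_delta // rs_reflection //.
  by rewrite opprB addrCA subrr addr0 subrr.
have ct0 : {in S, forall t, t != s -> c t = 0%R}.
  move=> t St /negPf ts; have := e0 t St; rewrite ts subr0 => /eqP.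
  by rewrite paddr_eq0 // => /andP[/eqP].
have ac' : a = (c s *: alpha s)%R.
  rewrite {1}ac (bigD1 s) //= big1 ?addr0 // => t /andP[St ts].
  by rewrite ct0 // scale0r.
have := root_unit ra; rewrite ac' rv_dotZl rv_dotZr rs_unit // mulr1 => cs2.
suff -> : c s = 1%R by rewrite scale1r.
by apply/eqP; rewrite -(@eqrXn2 _ 2) // ?ler01 // expr2 cs2 expr1n.
Qed.

Lemma act_faithful w : w \in W -> rho w = 1%:M%R -> w = 1.
Proof.
move=> Ww w1; apply/set1P.
by apply: (subsetP (rs_faithful Phi)); rewrite inE Ww mul1mx w1 eqxx.
Qed.

(** Both products act on vectors in the same way, and the representation is faithful. *)
Lemma simple_conj s t w : s \in S -> t \in S -> w \in W ->
  (alpha s ** w = alpha t)%R -> s * w = w * t.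
Proof.
move=> Ss St Ww st.
have [Ws Wt] := (simple_in_W Ss, simple_in_W St).
suff : (s * w) * (w * t)^-1 = 1 by move/eqP; rewrite -eq_mulgV1 => /eqP.
apply: act_faithful; first by rewrite !(groupM, groupV).
apply/row_matrixP=> i; rewrite !rowE mulmx1; set v := delta_mx _ _.
have key (u : vec) : (u ** (s * w) = u ** (w * t))%R.
  rewrite !act_mul // (rs_reflection Ss) (rs_reflection St) mulmxBl -scalemxAl st.
  by rewrite (rv_dotC u) -(dot_act _ _ Ww) st (rv_dotC (alpha t)).
have Wwt : w * t \in W by rewrite groupM.
by rewrite act_mul ?(groupM, groupV) // key act_K.
Qed.

(** Choose [w] with [l ** w] of maximal height: a simple root with negative scalar product would
    give a reflection increasing it. *)
Lemma exists_dominant (l : vec) :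
  exists2 w, w \in W & {in S, forall s, 0 <= rv_dot (alpha s) (l ** w)}%R.
Proof.
have [w Ww wmax] := arg_maxP (fun w => rv_dot (l ** w)%R hv) (group1 W).
exists w => // s Ss; have := wmax (w * s) (groupM Ww (simple_in_W Ss)).
rewrite /= act_mul ?(simple_in_W Ss) // (rs_reflection Ss) rv_dotBl rv_dotZl.
rewrite dot_height // mulr1 /=.
by rewrite gerBl pmulr_rge0 ?ltr0n // rv_dotC.
Qed.

Fixpoint ball (n : nat) : {set coset_of H} :=
  if n is m.+1 then ball m :|: S * ball m else 1.

Lemma ball_sub n : ball n \subset W.
Proof.
elim: n => [|n IHn] /=; first by rewrite sub1G.
rewrite subUset IHn mul_subG //.
by apply/subsetP => s /simple_in_W.
Qed.

Lemma ball_mul s w n : s \in S -> w \in ball n -> s * w \in ball n.+1.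
Proof. by move=> Ss bw; apply/setUP; right; apply: mem_mulg. Qed.

Lemma ball_mono m n : m <= n -> ball m \subset ball n.
Proof.
elim: n => [|n IHn]; first by rewrite leqn0 => /eqP->.
rewrite leq_eqVlt => /predU1P[-> //|]; rewrite ltnS => /IHn sub.
exact: subset_trans sub (subsetUl _ _).
Qed.

(** [ball] adds letters on the left, while the deletion argument below strips them on the right. *)
Lemma ball_r n : ball n.+1 = ball n :|: ball n * S.
Proof.
elim: n => [|n IHn]; first by rewrite /= mulg1 mul1g.
have eS : ball n.+1 :|: S * ball n = ball n.+1.
  by apply/setUidPl; rewrite /= subsetUr.
have eR : ball n.+1 :|: ball n * S = ball n.+1.
  by apply/setUidPl; rewrite IHn subsetUr.
rewrite [LHS]/= -/(ball n.+1) {2}IHn mulgU mulgA setUA eS.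
by rewrite [in RHS]/= mulUg setUA eR.
Qed.

Lemma ballV w n : w \in ball n -> w^-1 \in ball n.
Proof.
elim: n w => [|n IHn] w; first by rewrite /= => /set1P->; rewrite invg1 set11.
move=> bw; have /setUP[/IHn b|] : w \in ball n :|: S * ball n := bw.
  by rewrite inE b.
case/mulsgP=> s v Ss bv ->; rewrite invMg (simpleV Ss) ball_r inE.
by rewrite mem_mulg ?orbT ?IHn.
Qed.

Lemma ball_exists w : w \in W -> exists n, w \in ball n.
Proof.
move: w; apply: W_ind => [|s w Ss Ww [n bw]]; first by exists 0; apply: set11.
by exists n.+1; apply: ball_mul.
Qed.

(** The length with respect to [S]; the default value [0] is taken only outside [W]. *)
Definition wlen (w : coset_of H) : nat :=
  if pselect (exists n, w \in ball n) is left e then ex_minn e else 0.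

Lemma wlen_ball w : w \in W -> w \in ball (wlen w).
Proof.
move=> Ww; rewrite /wlen; case: pselect => [e|[]]; last exact: ball_exists.
by case: ex_minnP.
Qed.

Lemma wlen_min w n : w \in ball n -> wlen w <= n.
Proof.
move=> bw; rewrite /wlen; case: pselect => [e|//].
by case: ex_minnP => m _; apply.
Qed.

Lemma wlen_eq0 w : w \in W -> (wlen w == 0) = (w == 1).
Proof.
move=> Ww; apply/eqP/eqP => [w0|->].
  by have := wlen_ball Ww; rewrite w0 => /set1P.
by apply/eqP; rewrite -leqn0; apply: wlen_min; apply: set11.
Qed.

Lemma wlenV w : w \in W -> wlen w^-1 = wlen w.
Proof.
move=> Ww; have Ww' : w^-1 \in W by rewrite groupV.
apply/eqP; rewrite eqn_leq (wlen_min (ballV (wlen_ball Ww))).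
by have := wlen_min (ballV (wlen_ball Ww')); rewrite invgK.
Qed.

Lemma wlen_mul s w : s \in S -> w \in W -> wlen (s * w) <= (wlen w).+1.
Proof. by move=> Ss Ww; apply/wlen_min/ball_mul/wlen_ball. Qed.

Lemma wlen_mul' s w : s \in S -> w \in W -> wlen w <= (wlen (s * w)).+1.
Proof.
move=> Ss Ww; rewrite -{1}[w](mulKg s) (simpleV Ss) wlen_mul //.
by rewrite groupM ?(simple_in_W Ss).
Qed.

Lemma wlen_decomp w : w \in W -> w != 1 ->
  exists s v, [/\ s \in S, v \in W, w = s * v & wlen v < wlen w].
Proof.
move=> Ww w1; have := wlen_ball Ww; case e: (wlen w) => [|n].
  by move: w1; rewrite -wlen_eq0 // e.
rewrite /= inE => /orP[/wlen_min|]; first by rewrite e ltnn.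
case/mulsgP=> s v Ss bv ->; exists s, v; split=> //.
  exact: (subsetP (ball_sub n)).
by rewrite ltnS wlen_min.
Qed.

(* The deletion condition: in a word for w, the first letter at which the
   image of alpha s becomes negative can be cancelled against s. *)
Lemma ball_exchange s w n : s \in S -> w \in ball n ->
  (rv_dot (alpha s ** w)%R hv < 0)%R -> s * w \in ball n.-1.
Proof.
move=> Ss; have Ws := simple_in_W Ss.
elim: n w => [|n IHn] w bw.
  by move: bw => /set1P->; rewrite repr_mx1 mulmx1 dot_height // ltr10.
case: n IHn bw => [|n] IHn; rewrite ball_r => /setUP[bw|].
- by move=> st0; apply: IHn.
- case/mulsgP=> v t /set1P-> St ->{w}; rewrite mul1g => st0.
  suff e : alpha s = alpha t.
    have := simple_conj Ss St (group1 W); rewrite repr_mx1 mulmx1 mulg1 mul1g.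
    by move/(_ e)->; rewrite simple_mul_self //= set11.
  by apply: sign_change; rewrite ?dot_height ?ltr01 //; apply: root_simple.
- by move=> st0; apply: (subsetP (ball_mono (leqnSn n))); apply: IHn.
case/mulsgP=> v t bv St ->.
have [Wv Wt] := (subsetP (ball_sub _) v bv, simple_in_W St).
rewrite act_mul // => st0.
have ra : is_root (alpha s ** v)%R by apply: root_act (root_simple _).
case: (boolP (0 < rv_dot (alpha s ** v) hv)%R) => [v0|].
  rewrite mulgA (simple_conj Ss St) //; last exact: sign_change.
  by rewrite -mulgA simple_mul_self // mulg1.
rewrite -height_leNlt // => /(IHn _ bv) sv.
by rewrite mulgA [n.+2.-1]/= ball_r; apply/setUP; right; apply: mem_mulg.
Qed.

Lemma wlen_lt_neg s w : s \in S -> w \in W ->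
  (rv_dot (alpha s ** w)%R hv < 0)%R -> wlen (s * w) < wlen w.
Proof.
move=> Ss Ww sw0; have := wlen_min (ball_exchange Ss (wlen_ball Ww) sw0).
case e: (wlen w) => [|n] //=; have/eqP := e; rewrite wlen_eq0 // => /eqP w1.
by move: sw0; rewrite w1 repr_mx1 mulmx1 dot_height // ltr10.
Qed.

Lemma wlen_lt_pos s w : s \in S -> w \in W ->
  (0 < rv_dot (alpha s ** w)%R hv)%R -> wlen w < wlen (s * w).
Proof.
move=> Ss Ww sw0; have Ws := simple_in_W Ss.
rewrite -{1}[w](mulKg s) (simpleV Ss) wlen_lt_neg ?groupM // act_mul //.
by rewrite simple_reflects // mulNmx rv_dotNl oppr_lt0.
Qed.

(** If [w] is not [1], cancelling a suitable first letter shortens it, so by [wlen_lt_pos] the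
    simple root of that letter cannot stay positive. *)
Lemma pos_simple_id w : w \in W ->
  {in S, forall s, 0 < rv_dot (alpha s ** w) hv}%R -> w = 1.
Proof.
move=> Ww pw; apply/eqP; apply/negPn/negP => w1.
have [s [v [Ss Wv defw lt]]] := wlen_decomp Ww w1.
have := wlen_lt_pos Ss Ww (pw s Ss).
by rewrite {2}defw mulgA simple_mul_self // mul1g ltnNge (ltnW lt).
Qed.

Lemma wlen_bounded : exists M, {in W, forall w, wlen w <= M}.
Proof.
exists (\max_(w in W) wlen w) => w Ww.
exact: (@leq_bigmax_cond _ (fun w => w \in W) wlen).
Qed.

Lemma gen_simple_sub (J : {set coset_of H}) : J \subset S -> <<J>> \subset W.
Proof.
by move=> sJS; rewrite gen_subG; apply/subsetP=> s /(subsetP sJS)/simple_in_W.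
Qed.

Lemma parabolic_fix (J : {set coset_of H}) (l : vec) w : J \subset S ->
  {in J, forall s, rv_dot (alpha s) l = 0%R} -> w \in <<J>> -> (l ** w)%R = l.
Proof.
move=> sJS lJ Jw.
have gA : group_set [set w in W | l ** w == l]%R.
  apply/group_setP; split; first by rewrite inE group1 repr_mx1 mulmx1 eqxx.
  move=> x y; rewrite !inE => /andP[Wx /eqP lx] /andP[Wy /eqP ly].
  by rewrite groupM // act_mul // lx ly eqxx.
suff /subsetP/(_ w Jw) : <<J>> \subset Group gA by rewrite inE => /andP[_ /eqP].
rewrite gen_subG; apply/subsetP=> s Js; have Ss := subsetP sJS s Js.
rewrite inE simple_in_W // rs_reflection // (rv_dotC l) lJ // mulr0 scale0r.
by rewrite subr0 eqxx.
Qed.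

(** The roots orthogonal to a dominant [l] form the root system of [<<J>>]. For a positive such root
    [a], take [w] in [<<J>>] with [a ** w] positive of least height. Only simple roots from [J]
    occur in [a ** w], and reflecting in a suitable one of them would lower the height; by
    minimality the reflection makes the root negative, so [sign_change] applies. *)
Lemma root_parabolic (J : {set coset_of H}) a (l : vec) : J \subset S ->
    is_root a -> {in S, forall s, (0 <= rv_dot (alpha s) l)%R} ->
    {in S, forall s, (rv_dot (alpha s) l == 0%R) = (s \in J)} ->
    rv_dot a l = 0%R ->
  exists t w, [/\ t \in J, w \in <<J>> & a = (alpha t ** w)%R].
Proof.
move=> sJS ra l0 lJ al.
have sJW := gen_simple_sub sJS.
wlog a0 : a ra al / (0 < rv_dot a hv)%R => [IH|].
  case: (boolP (0 < rv_dot a hv)%R) => [/(IH a ra al) //|].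
  rewrite -height_leNlt // => a0.
  have [||| t [w [Jt Jw aE]]] := IH (- a)%R.
  - exact: root_opp.
  - by rewrite rv_dotNl al oppr0.
  - by rewrite rv_dotNl oppr_gt0.
  exists t, (t * w); split=> //; first by rewrite groupM // mem_gen.
  have St := subsetP sJS t Jt; have Ww := subsetP sJW w Jw.
  by rewrite act_mul ?(simple_in_W St) // simple_reflects // mulNmx -aE opprK.
pose P w := (w \in <<J>>) && (0 < rv_dot (a ** w) hv)%R.
have P1 : P 1 by rewrite /P group1 repr_mx1 mulmx1.
have [w /andP[Jw aw0] wmin] := arg_minP (fun w => rv_dot (a ** w)%R hv) P1.
have Ww := subsetP sJW w Jw; have rw := root_act Ww ra.
have [c [c0 ac]] := height_pos rw aw0.
have lw : (l ** w)%R = l.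
  apply: (parabolic_fix sJS) => // s Js; apply/eqP.
  by rewrite lJ // (subsetP sJS).
have awl : rv_dot (a ** w)%R l = 0%R by rewrite -lw dot_act.
have cJ : {in S, forall s, s \notin J -> c s = 0%R}.
  by move=> s Ss Js; apply: (nonneg_dot_eq0 c0 ac l0 awl) => //; rewrite lJ.
(* Otherwise the product of [a ** w] with itself, expanded over [J], would be nonpositive, but it
   equals 1. *)
have [t Jt at0] : exists2 t, t \in J & (0 < rv_dot (alpha t) (a ** w))%R.
  apply: contrapT => noex.
  have le0 : {in J, forall t, rv_dot (alpha t) (a ** w) <= 0}%R.
    by move=> t Jt; rewrite leNgt; apply/negP => lt0; apply: noex; exists t.
  have := root_unit rw; rewrite {1}ac rv_dot_suml => /eqP.
  suff h : (\sum_(s in S) rv_dot (c s *: alpha s) (a ** w) <= 0)%R.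
    by move=> /eqP h1; move: h; rewrite h1 ler10.
  apply: sumr_le0 => s Ss; rewrite rv_dotZl.
  case: (boolP (s \in J)) => [/le0|/(cJ s Ss)->]; last by rewrite mul0r.
  exact: mulr_ge0_le0.
have St := subsetP sJS t Jt; have Wt := simple_in_W St.
have defa : (a ** w)%R = alpha t.
  apply: sign_change => //; rewrite height_leNlt; last exact: root_act.
  apply/negP=> h; have := wmin (w * t).
  rewrite /P groupM ?(mem_gen Jt) // act_mul // => /(_ h).
  rewrite /= (rs_reflection St) rv_dotBl rv_dotZl dot_height // mulr1.
  by rewrite lerDl oppr_ge0 pmulr_rle0 ?ltr0n // rv_dotC leNgt at0.
by exists t, w^-1; rewrite groupV -defa act_K.
Qed.

End WeylGroup.

(** * The Bruhat decomposition *)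

Section BruhatCells.

Variables (R : realType) (gT : finGroupType) (p : nat) (G : {group gT}).
Variables (D : split_BN_pair p G) (Phi : root_system R D).

Local Notation B := (bnB D).
Local Notation N := (bnN D).
Local Notation H := (bnH D).
Local Notation S := (bnS D).
Local Notation W := (weyl_group D).
Local Notation rho := (rs_repr Phi).
Local Notation alpha := (rs_simple Phi).
Local Notation "v ** w" := (mulmx v (rho w%g))
  (at level 40, left associativity) : ring_scope.
Local Notation hv := (height_vec Phi).

Lemma sBG : B \subset G.
Proof. by rewrite -(BN_gen (bn_pair D)) sub_gen ?subsetUl. Qed.

Lemma sNG : N \subset G.
Proof. by rewrite -(BN_gen (bn_pair D)) sub_gen ?subsetUr. Qed.

Lemma sHB : H \subset B.
Proof. by rewrite -(BN_cap (bn_pair D)) subsetIl. Qed.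

Lemma sHN : H \subset N.
Proof. by rewrite -(BN_cap (bn_pair D)) subsetIr. Qed.

Lemma nHN : N \subset 'N(H).
Proof. exact: normal_norm (BN_normal (bn_pair D)). Qed.

Lemma coset_in_W n : n \in N -> coset H n \in W.
Proof. exact: mem_quotient. Qed.

Lemma cosetM n m : n \in N -> m \in N -> coset H (n * m) = coset H n * coset H m.
Proof. by move=> Nn Nm; rewrite morphM ?(subsetP nHN). Qed.

Lemma cosetVN n : n \in N -> coset H n^-1 = (coset H n)^-1.
Proof. by move=> Nn; rewrite morphV ?(subsetP nHN). Qed.

Lemma cosetN_eq n m : n \in N -> m \in N -> coset H n = coset H m ->
  exists2 h, h \in H & n = h * m.
Proof.
move=> Nn Nm /(rcoset_kercosetP (subsetP nHN n Nn) (subsetP nHN m Nm)).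
by case/rcosetP=> h Hh ->; exists h.
Qed.

Lemma W_rep w : w \in W -> exists2 n, n \in N & coset H n = w.
Proof. by case/morphimP=> n _ Nn ->; exists n. Qed.

Lemma repr_in_N w : w \in W -> repr w \in N.
Proof.
case/W_rep=> n Nn <-; rewrite val_coset ?(subsetP nHN) //.
have /rcosetP[h Hh ->] := mem_repr_rcoset H n.
by rewrite groupM // (subsetP sHN).
Qed.

Definition cell_def (w : coset_of H) : {set gT} :=
  [set x | [exists b in B, exists n in N, exists c in B,
     (coset H n == w) && (x == b * n * c)]].

(* Locked, so that failing unifications do not compute in the finite quotient
   group W. *)
Fact cell_key : unit. Proof. exact: tt. Qed.
Definition cell := locked_with cell_key cell_def.

Lemma cellP w x : reflect (exists b n c,
  [/\ b \in B, n \in N, c \in B, coset H n = w & x = b * n * c]) (x \in cell w).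
Proof.
rewrite [cell]unlock inE; apply: (iffP exists_inP) => [[b Bb]|[b [n [c [Bb Nn Bc wE ->]]]]].
  case/exists_inP=> n Nn /exists_inP[c Bc /andP[/eqP <- /eqP->]].
  by exists b, n, c.
exists b => //; apply/exists_inP; exists n => //.
by apply/exists_inP; exists c => //; rewrite wE !eqxx.
Qed.

Lemma cell_id n : n \in N -> n \in cell (coset H n).
Proof.
by move=> Nn; apply/cellP; exists 1, n, 1; rewrite !group1 mul1g mulg1.
Qed.

Lemma cell_bimul w b c x : b \in B -> c \in B ->
  (b * x * c \in cell w) = (x \in cell w).
Proof.
have imp y d e : d \in B -> e \in B -> y \in cell w -> d * y * e \in cell w.
  move=> Bd Be /cellP[b' [n [c' [Bb Nn Bc wE ->]]]].
  by apply/cellP; exists (d * b'), n, (c' * e); rewrite !groupM //; split=> //;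
     rewrite !mulgA.
move=> Bb Bc; apply/idP/idP; last exact: imp.
move/(imp _ b^-1 c^-1); rewrite !groupV => /(_ Bb Bc).
by rewrite !mulgA mulVg mul1g mulgK.
Qed.

Lemma cell_mull w b x : b \in B -> (b * x \in cell w) = (x \in cell w).
Proof. by move=> Bb; rewrite -(mulg1 (b * x)) cell_bimul. Qed.

Lemma cell_mulr w b x : b \in B -> (x * b \in cell w) = (x \in cell w).
Proof. by move=> Bb; rewrite -(mul1g (x * b)) mulgA cell_bimul. Qed.

Lemma cell_rep n x : n \in N -> x \in cell (coset H n) ->
  exists b c, [/\ b \in B, c \in B & x = b * n * c].
Proof.
move=> Nn /cellP[b [m [c [Bb Nm Bc nm ->]]]].
have [h Hh ->] := cosetN_eq Nm Nn nm.
exists (b * h), c; split=> //; last by rewrite !mulgA.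
by rewrite groupM // (subsetP sHB).
Qed.

Lemma cellV w x : w \in W -> x \in cell w -> x^-1 \in cell w^-1.
Proof.
move=> Ww /cellP[b [n [c [Bb Nn Bc <- ->]]]].
rewrite !invMg mulgA cell_bimul ?groupV // -cosetVN //.
by rewrite cell_id ?groupV.
Qed.

Lemma cell1 x : (x \in cell 1) = (x \in B).
Proof.
apply/idP/idP => [|Bx]; last first.
  by rewrite -(mulg1 x) cell_mull // -(morph1 (coset H)) cell_id.
rewrite -(morph1 (coset H)) => /(cell_rep (group1 N))[b [c [Bb Bc ->]]].
by rewrite mulg1 groupM.
Qed.

Lemma cell_mul s w x y : s \in S -> w \in W -> x \in cell s -> y \in cell w ->
  x * y \in cell (s * w) \/ x * y \in cell w.
Proof.
move=> Ss Ww /cellP[b [n [c [Bb Nn Bc sE ->]]]].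
case/cellP=> [b' [m [c' [Bb' Nm Bc' wE ->]]]].
have -> : b * n * c * (b' * m * c') = b * (n * (c * b') * m) * c'.
  by rewrite !mulgA.
rewrite !(cell_bimul _ _ Bb Bc').
have := BN_mul (bn_pair D) Nn Nm; rewrite sE => /(_ Ss)/subsetP.
move/(_ (n * (c * b') * m)); rewrite mem_rcoset mulgK mem_lcoset mulKg.
rewrite groupM // => /(_ isT); case/setUP => /mulsgP[u v /rcosetP[u' Bu ->]].
  move=> Bv ->; left; rewrite cell_bimul // -sE -wE -cosetM //.
  by rewrite cell_id ?groupM.
by move=> Bv ->; right; rewrite cell_bimul // -wE cell_id.
Qed.

Lemma cell_mul_r s w x y : s \in S -> w \in W -> x \in cell w -> y \in cell s ->
  x * y \in cell (w * s) \/ x * y \in cell w.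
Proof.
move=> Ss Ww wx sy; have Ws := simple_in_W Ss.
have sy' : y^-1 \in cell s by rewrite -(simpleV Ss) cellV.
have Ww' : w^-1 \in W by rewrite groupV.
have := cell_mul Ss Ww' sy' (cellV Ww wx).
rewrite -invMg => -[] /cellV; rewrite invgK => h; [left | right].
  by move: (h (groupM Ws Ww')); rewrite invMg invgK (simpleV Ss).
by move: (h Ww'); rewrite invgK.
Qed.

(** The union of the cells contains [B] and [N], and it is closed under multiplication because a
    cell can be multiplied in one letter at a time. *)
Lemma cell_cover g : g \in G -> exists2 w, w \in W & g \in cell w.
Proof.
pose A := \bigcup_(w in W) cell w.
suff sGA : G \subset A by move=> /(subsetP sGA)/bigcupP[w]; exists w.
have AM : {in W, forall w y, y \in A -> forall x, x \in cell w -> x * y \in A}.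
  apply: W_ind => [|s w Ss Ww IH] y Ay x.
    rewrite cell1 => Bx; case/bigcupP: Ay => v Wv vy; apply/bigcupP; exists v => //.
    by rewrite cell_mull.
  have [n Nn nE] := W_rep (simple_in_W Ss); have [m Nm mE] := W_rep Ww.
  rewrite -nE -mE -cosetM // => /cell_rep; rewrite groupM // => /(_ isT).
  case=> b [c [Bb Bc ->]].
  have : m * c * y \in A by apply: IH => //; rewrite cell_mulr // -mE cell_id.
  case/bigcupP=> v Wv vA.
  have sn : b * n \in cell s by rewrite cell_mull // -nE cell_id.
  have -> : b * (n * m) * c * y = b * n * (m * c * y) by rewrite !mulgA.
  case: (cell_mul Ss Wv sn vA) => hx; apply/bigcupP; last by exists v.
  by exists (s * v); rewrite ?groupM ?(simple_in_W Ss).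
have A1 : 1 \in A by apply/bigcupP; exists 1; rewrite ?group1 ?cell1.
have gA : group_set A.
  apply/group_setP; split=> // x y /bigcupP[w Ww wx] Ay; exact: AM wx.
rewrite -[A]/(gval (Group gA)) -(BN_gen (bn_pair D)) gen_subG subUset.
apply/andP; split; apply/subsetP=> x Px; apply/bigcupP.
  by exists 1; rewrite ?group1 ?cell1.
by exists (coset H x); rewrite ?coset_in_W ?cell_id.
Qed.

(** Induction on the length of the shorter element [w]. Multiplying by a representative of its first
    letter [s] moves from the cell of [w = s * v] to that of [v], and from the cell of [w'] to that
    of [s * w'] or of [w']; in the last case [v = w'], against the lengths. *)
Lemma cell_disjoint w w' x : w \in W -> w' \in W -> x \in cell w -> x \in cell w' ->
  w = w'.
Proof.
move=> Ww Ww'.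
wlog le : w w' Ww Ww' / wlen w <= wlen w' => [IH wx w'x|].
  case/orP: (leq_total (wlen w) (wlen w')) => le; first exact: IH.
  by apply/esym; apply: IH.
move: {2}(wlen w) (leqnn (wlen w)) => k.
elim: k w w' x Ww Ww' le => [|k IHk] w w' x Ww Ww' le lek wx w'x.
  move: lek; rewrite leqn0 wlen_eq0 // => /eqP w1.
  move: wx; rewrite {}w1 cell1 => Bx; have [n Nn nE] := W_rep Ww'.
  move: w'x; rewrite -nE => /(cell_rep Nn)[b [c [Bb Bc xE]]].
  have Bn : n \in B.
    have -> : n = b^-1 * x * c^-1 by rewrite xE !mulgA mulVg mul1g mulgK.
    by rewrite !groupM ?groupV.
  by rewrite coset_id // -(BN_cap (bn_pair D)) inE Bn.
have [w1|w1] := eqVneq w 1.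
  by apply: (IHk _ _ x) => //; rewrite w1 (eqP (_ : wlen 1 == 0)) ?wlen_eq0.
have [s [v [Ss Wv wE ltv]]] := wlen_decomp Ww w1.
have Ws := simple_in_W Ss.
have [n Nn nE] := W_rep Ws; have [m Nm mE] := W_rep Ww.
have Nn' : n^-1 \in N by rewrite groupV.
have sn : n^-1 \in cell s by rewrite -(simpleV Ss) cellV // -nE cell_id.
have w'm : m \in cell w'.
  move: wx; rewrite -mE => /(cell_rep Nm)[b [c [Bb Bc xE]]].
  by move: w'x; rewrite xE cell_bimul.
have vm : n^-1 * m \in cell v.
  have -> : v = coset H (n^-1 * m).
    by rewrite cosetM ?cosetVN // nE mE wE mulKg.
  by rewrite cell_id ?groupM.
have lt1 : wlen v <= k by rewrite -ltnS (leq_trans ltv).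
case: (cell_mul Ss Ww' sn w'm) => h.
  rewrite wE (IHk v (s * w') _ Wv (groupM Ws Ww') _ _ vm h) //.
    by rewrite mulgA simple_mul_self // mul1g.
  by rewrite -ltnS (leq_trans ltv) // (leq_trans le) // wlen_mul'.
have le' : wlen v <= wlen w' by apply: leq_trans (ltnW ltv) le.
have e := IHk v w' _ Wv Ww' le' lt1 vm h.
by move: (leq_trans ltv le); rewrite e ltnn.
Qed.

(** Induction on the length of [w = v^-1 * t]. If the product stayed in the cell of [w], removing
    [t] on the right would give an element which is in the cell of [s * v^-1] by induction, and also
    in that of [v^-1] or of [w]. Disjointness contradicts the lengths in both cases. *)
Lemma cell_mul_long s w x y : s \in S -> w \in W -> wlen w < wlen (s * w) ->
  x \in cell s -> y \in cell w -> x * y \in cell (s * w).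
Proof.
move=> Ss Ww lt sx; have Ws := simple_in_W Ss.
move: {2}(wlen w) (leqnn (wlen w)) => k lek.
elim: k w y Ww lek lt => [|k IHk] w y Ww lek lt wy.
  move: lek wy; rewrite leqn0 wlen_eq0 // => /eqP->; rewrite cell1 mulg1 => By.
  by rewrite cell_mulr.
have [w1|w1] := eqVneq w 1.
  by apply: IHk => //; rewrite w1 (eqP (_ : wlen 1 == 0)) ?wlen_eq0.
have Ww' : w^-1 \in W by rewrite groupV.
have [|t [v [St Wv wE ltv]]] := wlen_decomp Ww'; first by rewrite eq_invg1.
have Wt := simple_in_W St; have Wv' : v^-1 \in W by rewrite groupV.
have {}wE : w = v^-1 * t by rewrite -[w]invgK wE invMg (simpleV St).
have {}ltv : wlen v^-1 < wlen w by rewrite wlenV // -(wlenV Ww).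
case: (cell_mul Ss Ww sx wy) => // wxy; exfalso.
have [n Nn nE] := W_rep Wt.
have tn : n \in cell t by rewrite -nE cell_id.
have wtv : w * t = v^-1 by rewrite wE -mulgA simple_mul_self // mulg1.
have lt' : wlen v^-1 < wlen (s * v^-1).
  apply: leq_trans ltv _; rewrite -ltnS; apply: leq_trans lt _.
  have -> : s * w = (t * (s * v^-1)^-1)^-1.
    by rewrite invMg invgK (simpleV St) wE mulgA.
  by rewrite wlenV ?(groupM, groupV) // -[wlen (s * v^-1)]wlenV ?wlen_mul ?(groupM, groupV).
have [m Nm mE] := W_rep Wv'.
move: wy wxy; rewrite wE => wy wxy.
have [b [c [Bb Bc yE]]] : exists b c, [/\ b \in B, c \in B & y = b * (m * n) * c].
  by apply: cell_rep; rewrite ?groupM // cosetM // mE nE.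
have wxy' : x * (b * m * n) \in cell (v^-1 * t).
  by move: wxy; rewrite yE !mulgA cell_mulr // !mulgA.
have vm : b * m \in cell v^-1 by rewrite cell_mull // -mE cell_id.
have h1 : x * (b * m) \in cell (s * v^-1).
  by apply: IHk => //; rewrite -ltnS (leq_trans ltv).
have Wsv : s * v^-1 \in W by rewrite groupM.
have h2 : x * (b * m) = x * (b * m * n) * n^-1 by rewrite !mulgA mulgK.
have tn' : n^-1 \in cell t by rewrite -(simpleV St) cellV.
case: (cell_mul_r St _ wxy' tn'); rewrite ?(groupM, groupV) // -h2 => h3.
  move: h3; rewrite -wE wtv => /(cell_disjoint Wsv Wv' h1) e.
  by move: lt'; rewrite e ltnn.
have e := cell_disjoint Wsv _ h1 h3; move: lt.
rewrite wE -e ?groupM // mulgA simple_mul_self // mul1g e ?groupM //.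
by rewrite -wE ltnNge (ltnW ltv).
Qed.

Lemma cell_mul_up s w x y : s \in S -> w \in W ->
    (0 < rv_dot (alpha s ** w)%R hv)%R ->
  x \in cell s -> y \in cell w -> x * y \in cell (s * w).
Proof. by move=> Ss Ww pw; apply: cell_mul_long => //; apply: wlen_lt_pos pw. Qed.

End BruhatCells.

(** * Root subgroups, and the generation of [U] by the positive ones *)

Section RootSubgroupBasics.

Variables (R : realType) (gT : finGroupType) (p : nat) (G : {group gT}).
Variables (D : split_BN_pair p G) (Phi : root_system R D).

Local Notation B := (bnB D).
Local Notation N := (bnN D).
Local Notation U := (bnU D).
Local Notation H := (bnH D).
Local Notation S := (bnS D).
Local Notation W := (weyl_group D).
Local Notation rho := (rs_repr Phi).
Local Notation alpha := (rs_simple Phi).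
Local Notation vec := 'rV[R]_(rs_rank Phi).
Local Notation "v ** w" := (mulmx v (rho w%g))
  (at level 40, left associativity) : ring_scope.
Local Notation hv := (height_vec Phi).
Local Notation X := (root_subgroup Phi).
Local Notation rt := (root_at Phi).

Definition longest (w : coset_of H) : Prop :=
  {in S, forall s, (rv_dot (alpha s ** w)%R hv < 0)%R}.

Lemma longest_neg w a : w \in W -> longest w -> is_root a ->
  (0 < rv_dot a hv)%R -> (rv_dot (a ** w)%R hv < 0)%R.
Proof.
move=> Ww lw ra a0; rewrite height_leNlt; last exact: root_act.
rewrite -leNgt dot_actl // -oppr_ge0 -rv_dotNr; apply: nonneg_dot.
  exact: height_pos.
by move=> s Ss; rewrite rv_dotNr oppr_ge0 -dot_actl // ltW ?lw.
Qed.

Lemma longestV w : w \in W -> longest w -> longest w^-1.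
Proof.
move=> Ww lw s Ss; have Ww' : w^-1 \in W by rewrite groupV.
have ra := root_act Ww' (root_simple Phi Ss).
rewrite height_leNlt //; apply/negP=> /(longest_neg Ww lw ra).
by rewrite act_KV // dot_height // ltr10.
Qed.

Lemma longest_uniq w w' : w \in W -> w' \in W -> longest w -> longest w' -> w = w'.
Proof.
move=> Ww Ww' lw lw'; apply/eqP; rewrite eq_mulgV1; apply/eqP.
have Wv : w'^-1 \in W by rewrite groupV.
apply: (@pos_simple_id _ _ _ _ _ Phi); first by rewrite groupM.
move=> s Ss; rewrite act_mul //.
have ra := root_act Ww (root_simple Phi Ss).
have := longest_neg Wv (longestV Ww' lw') (root_opp ra).
rewrite rv_dotNl oppr_gt0 => /(_ (lw s Ss)).
by rewrite mulNmx rv_dotNl oppr_lt0.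
Qed.

(** The inverse of an element making [- hv] dominant is longest. *)
Lemma longest_exists : exists2 w, w \in W & longest w.
Proof.
have [w Ww wd] := exists_dominant (- hv)%R.
have Ww' : w^-1 \in W by rewrite groupV.
exists w^-1 => // s Ss; rewrite height_leNlt; last first.
  exact: root_act (root_simple _ Ss).
rewrite -leNgt dot_actl // invgK -oppr_ge0 -rv_dotNr -mulNmx.
exact: wd.
Qed.

Local Notation w0 := (w0_rep Phi).

(** In particular the default value [1] in [w0_rep] is never taken for lack of a candidate. *)
Lemma w0_repP : w0 \in N /\ longest (coset H w0).
Proof.
rewrite /w0_rep; case: pickP => [n /andP[Nn /forall_inP ln]|no] /=.
  split=> // s Ss; have /asboolP := ln s Ss.
  have ra := root_at_root Phi Ss Nn.
  by move/(nonneg_height (root_opp ra)); rewrite rv_dotNl oppr_gt0.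
have [w Ww lw] := longest_exists; have [n Nn nE] := W_rep Ww.
have /negP[] := negbT (no n); rewrite /longest_rep Nn; apply/forall_inP=> s Ss.
apply/asboolP/height_pos.
  exact/root_opp/root_at_root.
by rewrite rv_dotNl oppr_gt0 /root_at nE lw.
Qed.

Let Nw0 := w0_repP.1.
Let lw0 := w0_repP.2.

(** Descending induction on length: positivity of [rt s y] means that [repr s * y] is longer, and
    lengths in [W] are bounded. *)
Lemma N_up_ind (P : gT -> Prop) :
    {in N, forall y, {in S, forall s,
       (0 < rv_dot (rt s y) hv)%R -> P (repr s * y)} -> P y} ->
  {in N, forall y, P y}.
Proof.
move=> IH y Ny; have [M leM] := wlen_bounded D.
move: {2}(M - wlen (coset H y)) (leqnn (M - wlen (coset H y))) => k.
elim: k y Ny => [|k IHk] y Ny le; apply: IH => // s Ss sy.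
all: have Ws := simple_in_W Ss; have Ns := repr_in_N Ws.
all: have := wlen_lt_pos Ss (coset_in_W Ny) sy.
all: have := leM _ (groupM Ws (coset_in_W Ny)).
  move: le; rewrite leqn0 subn_eq0 => le le1 lt1.
  by have := leq_trans lt1 (leq_trans le1 le); rewrite ltnn.
move=> le1 lt1; apply: IHk; first by rewrite groupM.
rewrite leq_subLR in le; rewrite cosetM // coset_reprK leq_subLR.
by apply: leq_trans le _; rewrite -addSnnS leq_add2r.
Qed.

Lemma sUB : U \subset B.
Proof. by have /sdprod_context[/andP[]] := bn_split D. Qed.

Lemma nUB : B \subset 'N(U).
Proof. by have /sdprod_context[/andP[]] := bn_split D. Qed.

Lemma nUH : H \subset 'N(U).
Proof. exact: subset_trans (sHB D) nUB. Qed.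

Lemma nBN_H n : n \in N -> H :^ n = H.
Proof. by move=> Nn; apply/normP/(subsetP (nHN D)). Qed.

Lemma U_Hall : p.-Hall(B) U.
Proof.
have [nsU _ defB _ tiUH] := sdprod_context (bn_split D).
rewrite /pHall sUB (bn_pgroup D) /= -divgS ?sUB // -(sdprod_card (bn_split D)).
by rewrite mulKn ?cardG_gt0 //; apply: (bn_p'group D).
Qed.

Lemma p_sub_U (T : {group gT}) n : p.-group T -> T \subset B :^ n -> T \subset U :^ n.
Proof.
move=> pT sTB; rewrite -sub_conjgV; rewrite -sub_conjgV in sTB.
have [nsU _ _ _ _] := sdprod_context (bn_split D).
by rewrite (sub_normal_Hall U_Hall) // pgroupJ.
Qed.

Lemma p_sub_U1 (T : {group gT}) : p.-group T -> T \subset B -> T \subset U.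
Proof. by move=> pT; have := @p_sub_U T 1 pT; rewrite !conjsg1. Qed.

Lemma B_cap n x : n \in N -> x \in B -> x \in B :^ n ->
  exists u h, [/\ u \in U :&: U :^ n, h \in H & x = u * h].
Proof.
move=> Nn Bx Bnx; have [_ _ defB _ _] := sdprod_context (bn_split D).
have /mulsgP[u h Uu Hh xE] : x \in U * H by rewrite defB.
exists u, h; split=> //; rewrite inE Uu.
have Bnu : u \in B :^ n.
  have -> : u = x * h^-1 by rewrite xE mulgK.
  rewrite groupM // groupV; move: Hh; rewrite -{1}(nBN_H Nn).
  by apply: subsetP; rewrite conjSg sHB.
have : (U :&: B :^ n)%G \subset U :^ n.
  by apply: p_sub_U; rewrite ?subsetIr // (pgroupS (subsetIl _ _)) ?bn_pgroup.
by move/subsetP; apply; rewrite inE Uu.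
Qed.

Lemma conjB n m : n \in N -> m \in N -> coset H n = coset H m -> B :^ n = B :^ m.
Proof.
move=> Nn Nm /(cosetN_eq Nn Nm)[h Hh ->]; rewrite conjsgM.
by rewrite conjGid // (subsetP (sHB D)).
Qed.

Lemma conjU n m : n \in N -> m \in N -> coset H n = coset H m -> U :^ n = U :^ m.
Proof.
move=> Nn Nm /(cosetN_eq Nn Nm)[h Hh ->]; rewrite conjsgM.
by rewrite (normP (subsetP nUH h Hh)).
Qed.

Lemma simple_neq1 s : s \in S -> s != 1.
Proof.
by move=> Ss; rewrite -order_eq1 (BN_simple_order (bn_pair D)).
Qed.

(** For [g] in the intersection, [h = g ^ y^-1] lies in [B] or in the cell of [s]. In the second
    case [h * y] would lie in the cell of the longer element, although [h * y = y * g] lies in the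
    cell of [y]. *)
Lemma capB_step s y : s \in S -> y \in N -> (0 < rv_dot (rt s y) hv)%R ->
  B :&: B :^ (repr s * y) \subset B :^ y.
Proof.
move=> Ss Ny sy; have Ws := simple_in_W Ss; have Nm := repr_in_N Ws.
set m := repr s in Nm *; have mE : coset H m = s by rewrite coset_reprK.
apply/subsetP=> g /setIP[Bg]; rewrite !mem_conjg invMg conjgM.
set h := g ^ y^-1 => Bh.
have ms : m \in cell s by rewrite -mE cell_id.
have ms' : m^-1 \in cell s by rewrite -(simpleV Ss) cellV.
have hE : h = m^-1 * ((h ^ m^-1) * m) by rewrite -conjgE conjgKV.
have : m^-1 * ((h ^ m^-1) * m) \in cell (s * s) \/
       m^-1 * ((h ^ m^-1) * m) \in cell s.
  by apply: cell_mul => //; rewrite cell_mull.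
rewrite -hE simple_mul_self // cell1 => -[//|sh].
have Wy := coset_in_W Ny.
have yc : y \in cell (coset H y) by apply: cell_id.
have e1 : h * y \in cell (s * coset H y) := cell_mul_up Ss Wy sy sh yc.
have e2 : h * y \in cell (coset H y).
  have -> : h * y = y * g by rewrite /h conjgE invgK mulgA mulgKV.
  by rewrite cell_mulr.
have := cell_disjoint (groupM Ws Wy) Wy e1 e2.
by move/eqP; rewrite -{2}[coset H y]mul1g (inj_eq (mulIg _)) (negPf (simple_neq1 Ss)).
Qed.

Lemma capB_longest y : y \in N -> B :&: B :^ w0 \subset B :^ y.
Proof.
move: y; apply: N_up_ind => y Ny IH.
have [[s Ss sy]|no] := pselect (exists2 s, s \in S & (0 < rv_dot (rt s y) hv)%R).
  apply: subset_trans (capB_step Ss Ny sy).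
  by rewrite subsetI subsetIl IH.
have ly : longest (coset H y).
  move=> s Ss; rewrite height_leNlt; last exact: (root_at_root Phi Ss Ny).
  by apply/negP=> sy; apply: no; exists s.
have e := longest_uniq (coset_in_W Ny) (coset_in_W Nw0) ly lw0.
by rewrite (conjB Ny Nw0 e) subsetIr.
Qed.

(** By [capB_longest] the intersection lies in every [N]-conjugate of [B], hence in [H] by
    saturation, and [U] meets [H] trivially. *)
Lemma capU_longest : U :&: U :^ w0 = 1.
Proof.
have [_ _ _ _ tiUH] := sdprod_context (bn_split D).
apply/trivgP; rewrite -tiUH subsetI subsetIl -(bn_saturated D).
apply/bigcapsP=> n Nn; apply: subset_trans (capB_longest Nn).
by rewrite setISS ?conjSg ?sUB.
Qed.

(** As in [capB_longest], but climbing only through those [y] for which [rt s y^-1] stays positive.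
    The climb stops when [coset H y * s] is longest, that is at the class of [w0 * repr s]. *)
Lemma capB_simple s y : s \in S -> y \in N -> (0 < rv_dot (rt s y^-1) hv)%R ->
  B :&: B :^ (w0 * repr s) \subset B :^ y.
Proof.
move=> Ss Ny; have Ws := simple_in_W Ss; have Nm := repr_in_N Ws.
move: y Ny; apply: N_up_ind => y Ny IH sy.
have Wy := coset_in_W Ny.
have [[t [St ty ne]]|no] := pselect (exists t, [/\ t \in S,
    (0 < rv_dot (rt t y) hv)%R & rt t y <> alpha s]).
  have Nt := repr_in_N (simple_in_W St).
  apply: subset_trans (capB_step St Ny ty).
  rewrite subsetI subsetIl IH //.
  have Ny' : y^-1 \in N by rewrite groupV.
  rewrite /root_at invMg cosetM ?groupV // cosetVN // cosetVN // coset_reprK.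
  rewrite (simpleV St) act_mul ?groupV ?(simple_in_W St) //.
  have ra : is_root (alpha s ** (coset H y)^-1)%R.
    by apply: root_act (root_simple _ Ss); rewrite groupV.
  rewrite -[(0 < _)%R]negbK -height_leNlt; last exact: root_act (simple_in_W St) ra.
  apply/negP=> lt0; apply: ne; rewrite /root_at.
  rewrite /root_at cosetVN // in sy.
  by rewrite -(sign_change ra St sy lt0) act_KV.
have lys : longest (coset H y * s).
  move=> t St; rewrite act_mul //.
  have ra := root_at_root Phi St Ny.
  have [e|ne] := pselect (rt t y = alpha s).
    by rewrite -/(rt t y) e simple_reflects // rv_dotNl dot_height // oppr_lt0 ltr01.
  rewrite -oppr_gt0 -rv_dotNl -mulNmx -/(rt t y).
  rewrite -[(0 < _)%R]negbK -height_leNlt; last exact/(root_act Ws)/root_opp.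
  have ty : (0 < rv_dot (- rt t y) hv)%R.
    rewrite rv_dotNl oppr_gt0 height_leNlt //; apply/negP=> ty.
    by apply: no; exists t.
  apply/negP=> lt0; have e := sign_change (root_opp ra) Ss ty lt0.
  move: sy; rewrite /root_at -e cosetVN // mulNmx act_K // rv_dotNl oppr_gt0.
  by rewrite dot_height // ltr10.
have e := longest_uniq (groupM Wy Ws) (coset_in_W Nw0) lys lw0.
rewrite (conjB Ny (groupM Nw0 Nm)) ?subsetIr // cosetM // coset_reprK -e.
by rewrite -mulgA simple_mul_self // mulg1.
Qed.

Lemma simple_root_sub s : simple_root_subgroup Phi s \subset U.
Proof. exact: subsetIl. Qed.

Lemma simple_root_pgroup s : p.-group (simple_root_subgroup Phi s).
Proof. exact: pgroupS (simple_root_sub s) (bn_pgroup D). Qed.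

Lemma root_pos_sub s n : s \in S -> n \in N -> (0 < rv_dot (rt s n) hv)%R ->
  X s n \subset U.
Proof.
move=> Ss Nn sn; have Nn' : n^-1 \in N by rewrite groupV.
rewrite /root_subgroup sub_conjg.
have : (U :&: U :^ (w0 * repr s))%G \subset U :^ n^-1; last by [].
apply: p_sub_U; first exact: simple_root_pgroup.
apply: subset_trans (capB_simple Ss Nn' _); last by rewrite invgK.
by rewrite setISS ?conjSg ?sUB.
Qed.

(** With [m = repr s], the element [w0 * m * u * m^-1] lies in the cell of [w0]. Writing it as
    [b1 * w0 * b2] and conjugating gives [u = y * z]; it remains to put [y] and [z] into [B] and to
    cancel their components in [H]. *)
Lemma U_factor s : s \in S ->
  U \subset simple_root_subgroup Phi s * (U :&: U :^ repr s).
Proof.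
move=> Ss; have Ws := simple_in_W Ss; have Nm := repr_in_N Ws.
set m := repr s in Nm *; have mE : coset H m = s by rewrite coset_reprK.
apply/subsetP=> u Uu; have Bu := subsetP sUB u Uu.
have Ww0 := coset_in_W Nw0; set v0 := coset H w0 in Ww0.
have Nwm : w0 * m \in N by rewrite groupM.
have wmE : coset H (w0 * m) = v0 * s by rewrite cosetM // mE.
have Wvs : v0 * s \in W by rewrite groupM.
have ms : m \in cell s by rewrite -mE cell_id.
have ms' : m^-1 \in cell s by rewrite -(simpleV Ss) cellV.
have up x y : x \in cell (v0 * s) -> y \in cell s -> x * y \in cell v0.
  move=> xc yc; rewrite -[x * y]invgK -[v0]invgK.
  apply: cellV; rewrite ?groupV // invMg.
  have -> : v0^-1 = s * (v0 * s)^-1 by rewrite invMg (simpleV Ss) mulgA simple_mul_self // mul1g.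
  apply: cell_mul_long; rewrite ?groupV //.
  - rewrite invMg (simpleV Ss) mulgA simple_mul_self // mul1g.
    by apply: (wlen_lt_neg (Phi := Phi)); rewrite ?groupV //; apply: longestV.
  - by rewrite -(simpleV Ss) cellV.
  - exact: cellV.
have : w0 * m * u * m^-1 \in cell v0.
  by apply: up => //; rewrite cell_mulr // -wmE cell_id.
case/(cell_rep Nw0) => b1 [b2 [Bb1 Bb2 eb]].
set y := b1 ^ (w0 * m); set z := b2 ^ m.
have uE : u = y * z.
  rewrite -{1}(mulKg (w0 * m) u) -{1}(mulgKV m (w0 * m * u)) eb.
  by rewrite /y /z !conjgE !mulgA mulgK.
(* Otherwise [z], hence also [y], lies in the cell of [s]; then [w0 * m * y = b1 * (w0 * m)] lies in
   two different cells. *)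
have By : y \in B.
  have yE : y = u * z^-1 by rewrite uE mulgK.
  have : z \in cell (s * s) \/ z \in cell s.
    rewrite /z conjgE; apply: cell_mul => //.
    by rewrite cell_mull.
  rewrite simple_mul_self // cell1 => -[Bz|sz].
    by rewrite yE groupM // groupV.
  have sy : y \in cell s.
    by rewrite yE cell_mull // -(simpleV Ss) cellV.
  have e1 : w0 * m * y \in cell (v0 * s).
    by rewrite /y conjgE !mulgA mulgV mul1g -mulgA cell_mull // -wmE cell_id.
  have e2 : w0 * m * y \in cell v0.
    by apply: up => //; rewrite -wmE cell_id.
  have := cell_disjoint Wvs Ww0 e1 e2.
  by move/eqP; rewrite -{2}[v0]mulg1 (inj_eq (mulgI _)) (negPf (simple_neq1 Ss)).
have Bz : z \in B.
  have -> : z = y^-1 * u by rewrite uE mulKg.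
  by rewrite groupM ?groupV.
have [u1 [h1 [Uu1 Hh1 yE]]] : exists u1 h1,
   [/\ u1 \in U :&: U :^ (w0 * m), h1 \in H & y = u1 * h1].
  by apply: B_cap; rewrite ?memJ_conjg.
have [u2 [h2 [Uu2 Hh2 zE]]] : exists u2 h2,
   [/\ u2 \in U :&: U :^ m, h2 \in H & z = u2 * h2].
  by apply: B_cap; rewrite ?memJ_conjg.
have nUm : H \subset 'N(U :&: U :^ m).
  rewrite normsI ?nUH // -(nBN_H Nm) normJ conjSg; exact: nUH.
have Uu2' : u2 ^ h1^-1 \in U :&: U :^ m.
  by rewrite memJ_norm // groupV (subsetP nUm).
have uE' : u = u1 * (u2 ^ h1^-1) * (h1 * h2).
  by rewrite uE yE zE conjgE invgK !mulgA mulgKV.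
have h12 : h1 * h2 = 1.
  have [_ _ _ _ tiUH] := sdprod_context (bn_split D).
  apply/set1P; rewrite -[[set 1]]/(1%g : {set gT}) -tiUH inE [_ \in H]groupM // andbT.
  have -> : h1 * h2 = (u1 * (u2 ^ h1^-1))^-1 * u.
    by rewrite {1}uE' mulKg.
  rewrite groupM // groupV groupM //; first by case/setIP: Uu1.
  by case/setIP: Uu2'.
by rewrite uE' h12 mulg1 mem_mulg.
Qed.

(** Otherwise [U_factor] puts [U] inside its conjugate by [repr s], so that this element normalizes
    [B], against [BN_conj]. *)
Lemma simple_root_neq1 s : s \in S -> simple_root_subgroup Phi s != 1.
Proof.
move=> Ss; apply/eqP=> X1; have Ws := simple_in_W Ss; have Nm := repr_in_N Ws.
have := U_factor Ss; rewrite X1 mul1g subsetI subxx /= => sUUm.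
have := BN_conj (bn_pair D) Nm; rewrite coset_reprK => /(_ Ss)/eqP; apply.
have [_ _ defB _ _] := sdprod_context (bn_split D).
have eU : U :^ repr s = U by apply/esym/eqP; rewrite eqEcard sUUm cardJg /=.
by rewrite -{1}defB conjsMg eU nBN_H.
Qed.

Lemma root_neq1 s n : s \in S -> X s n != 1.
Proof.
move=> Ss; apply: contra (simple_root_neq1 Ss) => /eqP X1.
by rewrite -(conjsgK n (simple_root_subgroup Phi s)) -/(X s n) X1 conjs1g.
Qed.

(** The root subgroup of a negative root lies in [U :^ w0]. *)
Lemma root_neg_capU s n : s \in S -> n \in N -> (rv_dot (rt s n) hv < 0)%R ->
  X s n :&: U = 1.
Proof.
move=> Ss Nn sn; apply/trivgP.
have Nw0' : w0^-1 \in N by rewrite groupV.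
have lw := longestV (coset_in_W Nw0) lw0.
have sX : X s n \subset U :^ w0.
  rewrite -sub_conjgV /root_subgroup -conjsgM.
  apply: root_pos_sub; rewrite ?groupM //.
  have ra := root_at_root Phi Ss Nn.
  rewrite /root_at cosetM // act_mul ?coset_in_W // cosetVN //.
  rewrite -oppr_lt0 -rv_dotNl -mulNmx.
  apply: longest_neg => //; first by rewrite groupV coset_in_W.
    exact: root_opp.
  by rewrite rv_dotNl oppr_gt0.
by have := setIS U sX; rewrite capU_longest setIC.
Qed.

(** The factor from [N] in the Bruhat decomposition also normalizes [U]. If it made a simple root
    negative, the nontrivial root subgroup of the image would lie in [U], against
    [root_neg_capU]. *)
Lemma normU_sub : 'N_G(U) \subset B.
Proof.
apply/subsetP=> g /setIP[Gg nUg].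
have [w Ww] := cell_cover D Gg; case/cellP=> b [n [c [Bb Nn Bc nE gE]]].
have nUn : n \in 'N(U).
  have -> : n = b^-1 * g * c^-1 by rewrite gE !mulgA mulVg mul1g mulgK.
  by rewrite !groupM ?groupV // (subsetP nUB).
suff w1 : coset H n = 1.
  by rewrite gE -cell1 cell_bimul // -w1 cell_id.
apply: (@pos_simple_id _ _ _ _ _ Phi); first exact: coset_in_W.
move=> s Ss; have ra := root_at_root Phi Ss Nn.
rewrite -[(0 < _)%R]negbK -height_leNlt //; apply/negP=> sn.
have := root_neg_capU Ss Nn sn; rewrite (setIidPl _).
  by apply/eqP; apply: root_neq1.
by rewrite /root_subgroup -(normP nUn) conjSg simple_root_sub.
Qed.

Definition xgen (A : vec -> bool) : {set gT} :=
  <<\bigcup_(s in S) \bigcup_(n in N | A (rt s n)) X s n>>.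

Canonical xgen_group A := Eval hnf in [group of xgen A].

Lemma xgen_sub (A : vec -> bool) (M : {group gT}) :
  {in S & N, forall s n, A (rt s n) -> X s n \subset M} -> xgen A \subset M.
Proof.
move=> sM; rewrite gen_subG; apply/bigcupsP=> s Ss; apply/bigcupsP=> n.
by case/andP=> Nn; apply: sM.
Qed.

Lemma mem_xgen (A : vec -> bool) s n : s \in S -> n \in N -> A (rt s n) -> X s n \subset xgen A.
Proof.
move=> Ss Nn An; apply: sub_gen; apply: (bigcup_max s) => //.
by apply: (bigcup_max n); rewrite ?Nn.
Qed.

(** The intersections of [U] with its conjugates [U :^ y] are treated by [N_up_ind]: the one for the
    longest element is trivial, and [U_factor] splits off one positive root subgroup at each step
    down to [y = 1]. *)
Lemma xgen_U : xgen (fun a => 0 < rv_dot a hv)%R = U.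
Proof.
apply/eqP; rewrite eqEsubset; apply/andP; split.
  by apply: xgen_sub => s n Ss Nn; apply: root_pos_sub.
suff: {in N, forall y, U :&: U :^ y \subset xgen (fun a => 0 < rv_dot a hv)%R}.
  by move/(_ 1 (group1 _)); rewrite conjsg1 setIid.
apply: N_up_ind => y Ny IH.
have [[s Ss sy]|no] := pselect (exists2 s, s \in S & (0 < rv_dot (rt s y) hv)%R).
  apply/subsetP=> u /setIP[Uu]; rewrite mem_conjg => Uu'.
  have /mulsgP[x v Xx Uv uE] := subsetP (U_factor Ss) _ Uu'.
  have {}uE : u = x ^ y * v ^ y by rewrite -conjMg -uE conjgKV.
  have Xxy : x ^ y \in X s y by rewrite memJ_conjg.
  have Uxy := subsetP (root_pos_sub Ss Ny sy) _ Xxy.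
  rewrite uE; apply: groupM.
    by apply: (subsetP _ _ Xxy); apply: mem_xgen.
  apply: (subsetP (IH s Ss sy)); apply/setIP; split; last first.
    by rewrite conjsgM memJ_conjg; case/setIP: Uv.
  have -> : v ^ y = (x ^ y)^-1 * u by rewrite uE mulKg.
  by rewrite groupM ?groupV.
have ly : longest (coset H y).
  move=> s Ss; rewrite height_leNlt; last exact: (root_at_root Phi Ss Ny).
  by apply/negP=> sy; apply: no; exists s.
have e := longest_uniq (coset_in_W Ny) (coset_in_W Nw0) ly lw0.
by rewrite (conjU Ny Nw0 e) capU_longest sub1G.
Qed.

End RootSubgroupBasics.

(** * Unipotent, Levi and parabolic subgroups attached to a vector *)

Section VectorSubgroups.

Variables (R : realType) (gT : finGroupType) (p : nat) (G : {group gT}).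
Variables (D : split_BN_pair p G) (Phi : root_system R D).
Hypothesis hcomm : commutator_relations Phi.

Local Notation B := (bnB D).
Local Notation N := (bnN D).
Local Notation U := (bnU D).
Local Notation H := (bnH D).
Local Notation S := (bnS D).
Local Notation W := (weyl_group D).
Local Notation rho := (rs_repr Phi).
Local Notation alpha := (rs_simple Phi).
Local Notation vec := 'rV[R]_(rs_rank Phi).
Local Notation "v ** w" := (mulmx v (rho w%g))
  (at level 40, left associativity) : ring_scope.
Local Notation hv := (height_vec Phi).
Local Notation X := (root_subgroup Phi).
Local Notation rt := (root_at Phi).
Local Notation w0 := (w0_rep Phi).

Lemma root_atM s n m : n \in N -> m \in N ->
  rt s (n * m) = (rt s n ** coset H m)%R.
Proof. by move=> Nn Nm; rewrite /root_at cosetM // act_mul ?coset_in_W. Qed.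

Lemma root_subgroupJ s n m : X s n :^ m = X s (n * m).
Proof. by rewrite /root_subgroup conjsgM. Qed.

Lemma root_at_opp s n : s \in S -> n \in N -> rt s (repr s * n) = (- rt s n)%R.
Proof.
move=> Ss Nn; have Ws := simple_in_W Ss.
rewrite /root_at cosetM ?repr_in_N // coset_reprK act_mul ?coset_in_W //.
by rewrite simple_reflects // mulNmx.
Qed.

Lemma root_subG s n : s \in S -> n \in N -> X s n \subset G.
Proof.
move=> Ss Nn; rewrite /root_subgroup sub_conjg conjGid ?groupV ?(subsetP (sNG D)) //.
exact: subset_trans (simple_root_sub _ _) (subset_trans (sUB D) (sBG D)).
Qed.

Lemma xgen_subG (A : vec -> bool) : xgen A \subset G.
Proof. by apply: xgen_sub => s n Ss Nn _; apply: root_subG. Qed.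

Lemma xgenS (A A' : vec -> bool) : (forall a, is_root a -> A a -> A' a) ->
  xgen A \subset xgen A'.
Proof.
move=> sA; apply: xgen_sub => s n Ss Nn An; apply: mem_xgen => //.
by apply: sA => //; apply: root_at_root.
Qed.

Lemma eq_xgen (A A' : vec -> bool) : (forall a, is_root a -> A a = A' a) ->
  xgen A = xgen A'.
Proof.
by move=> eA; apply/eqP; rewrite eqEsubset !xgenS // => a ra; rewrite eA.
Qed.

Lemma xgen_normP (A : vec -> bool) x :
    {in S & N, forall s n, A (rt s n) -> X s n :^ x \subset xgen A} ->
  x \in 'N(xgen A).
Proof.
move=> nA; rewrite inE sub_conjg.
by apply: xgen_sub => s n Ss Nn An; rewrite -sub_conjg nA.
Qed.

Lemma xgenJ_sub (A A' : vec -> bool) m : m \in N ->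
    (forall a, is_root a -> A a -> A' (a ** coset H m)%R) ->
  xgen A :^ m \subset xgen A'.
Proof.
move=> Nm sA; rewrite sub_conjg; apply: xgen_sub => s n Ss Nn An.
rewrite -sub_conjg root_subgroupJ mem_xgen ?groupM // root_atM //.
by apply: sA => //; apply: root_at_root.
Qed.

Lemma simple_root_normH s : s \in S -> H \subset 'N(simple_root_subgroup Phi s).
Proof.
move=> Ss; have [Nw0 _] := w0_repP Phi.
have Nm : w0 * repr s \in N by rewrite groupM ?repr_in_N ?simple_in_W.
have : H :^ (w0 * repr s) \subset 'N(U) :^ (w0 * repr s) by rewrite conjSg nUH.
by rewrite -normJ nBN_H // => nU; rewrite normsI ?nUH.
Qed.

Lemma root_normH s n : s \in S -> n \in N -> H \subset 'N(X s n).
Proof.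
move=> Ss Nn.
have : H :^ n \subset 'N(simple_root_subgroup Phi s) :^ n.
  by rewrite conjSg simple_root_normH.
by rewrite -normJ nBN_H.
Qed.

Lemma xgen_normH (A : vec -> bool) : H \subset 'N(xgen A).
Proof.
apply/subsetP=> h Hh; apply: xgen_normP => s n Ss Nn An.
by rewrite (normP (subsetP (root_normH Ss Nn) h Hh)) mem_xgen.
Qed.

(** By the commutator relations, conjugating a root subgroup from [A'] by an element of one from [A]
    changes its elements only by root subgroups that are again in [A']. *)
Lemma xgen_norm (A A' : vec -> bool) :
    (forall a b, is_root a -> is_root b -> A a -> A' b ->
       [/\ a <> b, a <> (- b)%R & forall c, positive_comb a b c -> A' c]) ->
  xgen A \subset 'N(xgen A').
Proof.
move=> hA; apply: (xgen_sub (M := [group of 'N(xgen A')])) => s n Ss Nn An.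
apply/subsetP=> x Xx; apply: xgen_normP => t m St Nm Am.
apply/subsetP=> _ /imsetP[y Xy ->].
have [ne1 ne2 pc] := hA _ _ (root_at_root Phi Ss Nn) (root_at_root Phi St Nm) An Am.
rewrite conjg_mulR; apply: groupM; first by apply: (subsetP _ _ Xy); apply: mem_xgen.
have : [~ y, x] \in [~: X s n, X t m] by rewrite commGC; apply: mem_commg.
have /subsetP sc := hcomm Ss Nn St Nm ne1 ne2.
move/sc; apply: subsetP; rewrite gen_subG.
apply/bigcupsP=> u Su; apply/bigcupsP=> k /andP[Nk /asboolP uk].
by apply: mem_xgen => //; apply: pc.
Qed.

(* If l is dominant and J is the set of simple reflections fixing l, these are
   the unipotent radical of the standard parabolic subgroup P_J, its standard
   Levi complement L_J, and P_J itself. *)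
Definition Uv (l : vec) : {group gT} := xgen_group (Phi := Phi) (fun a => 0 < rv_dot a l)%R.
Definition Lv (l : vec) : {group gT} :=
  (H <*> xgen_group (Phi := Phi) (fun a => rv_dot a l == 0)%R)%G.
Definition Pv (l : vec) : {group gT} :=
  (H <*> xgen_group (Phi := Phi) (fun a => 0 <= rv_dot a l)%R)%G.

Lemma sHG : H \subset G.
Proof. exact: subset_trans (sHB D) (sBG D). Qed.

Lemma sLvG l : Lv l \subset G.
Proof. by rewrite /= join_subG sHG xgen_subG. Qed.

Lemma sPvG l : Pv l \subset G.
Proof. by rewrite /= join_subG sHG xgen_subG. Qed.

Lemma sUvG l : Uv l \subset G.
Proof. exact: xgen_subG. Qed.

(** A positive combination of a root orthogonal to [l] and a root positive on [l] is positive on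
    [l]. *)
Lemma Lv_normUv l : Lv l \subset 'N(Uv l).
Proof.
rewrite /= join_subG xgen_normH; apply: xgen_norm => a b _ _ /eqP a0 b0; split.
- by move=> ab; move: b0; rewrite -ab a0 ltxx.
- by move=> ab; move: b0; rewrite -oppr_lt0 -rv_dotNl -ab a0 ltxx.
by move=> c [x [y [x0 y0 ->]]]; rewrite rv_dotDl !rv_dotZl a0 mulr0 add0r mulr_gt0.
Qed.

Lemma LvN l : Lv (- l)%R :=: Lv l.
Proof.
by congr (H <*> _); apply: eq_xgen => a _; rewrite rv_dotNr oppr_eq0.
Qed.

Lemma Lv_normUvN l : Lv l \subset 'N(Uv (- l)%R).
Proof. by rewrite -LvN Lv_normUv. Qed.

Lemma PvE l : Pv l :=: Uv l * Lv l.
Proof.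
rewrite -norm_joinEr ?Lv_normUv //.
apply/eqP; rewrite eqEsubset; apply/andP; split.
  rewrite /= join_subG; apply/andP; split.
    exact: subset_trans (joing_subl _ _) (joing_subr _ _).
  apply: (xgen_sub (M := [group of Uv l <*> Lv l])) => s n Ss Nn.
  rewrite le_eqVlt eq_sym => /orP[a0|a0].
    apply: subset_trans (joing_subr _ _); apply: subset_trans (joing_subr _ _).
    exact: mem_xgen.
  by apply: subset_trans (joing_subl _ _); apply: mem_xgen.
rewrite /= !join_subG joing_subl /=; apply/andP; split.
  by apply: subset_trans (joing_subr _ _); apply: xgenS => a _ /ltW.
by apply: subset_trans (joing_subr _ _); apply: xgenS => a _ /eqP->.
Qed.

Lemma sUvPv l : Uv l \subset Pv l.
Proof. by rewrite PvE mulG_subl. Qed.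

Lemma sLvPv l : Lv l \subset Pv l.
Proof. by rewrite PvE mulG_subr. Qed.

Lemma UvJ l m : m \in N -> Uv l :^ m = Uv (l ** coset H m)%R.
Proof.
move=> Nm; have Wm := coset_in_W Nm; apply/eqP; rewrite eqEsubset.
rewrite xgenJ_sub //=; last by move=> a _; rewrite dot_act.
rewrite -sub_conjgV xgenJ_sub ?groupV // => a _.
by rewrite cosetVN // dot_actl ?invgK ?groupV.
Qed.

Lemma LvJ l m : m \in N -> Lv l :^ m = Lv (l ** coset H m)%R.
Proof.
move=> Nm; have Wm := coset_in_W Nm; rewrite /= conjYg nBN_H //; congr (H <*> _).
apply/eqP; rewrite eqEsubset.
rewrite xgenJ_sub //=; last by move=> a _; rewrite dot_act.
rewrite -sub_conjgV xgenJ_sub ?groupV // => a _.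
by rewrite cosetVN // dot_actl ?invgK ?groupV.
Qed.

Lemma PvJ l m : m \in N -> Pv l :^ m = Pv (l ** coset H m)%R.
Proof. by move=> Nm; rewrite !PvE conjsMg UvJ // LvJ. Qed.

Definition dominant (l : vec) : Prop :=
  {in S, forall s, (0 <= rv_dot (alpha s) l)%R}.

Lemma dominant_pos l a : dominant l -> is_root a -> (0 < rv_dot a l)%R ->
  (0 < rv_dot a hv)%R.
Proof.
move=> dl ra al; rewrite -[(0 < _)%R]negbK -height_leNlt //; apply/negP=> a0.
have na : nonneg_comb S alpha (- a)%R.
  by apply: height_pos; rewrite ?rv_dotNl ?oppr_gt0 //; apply: root_opp.
by have := nonneg_dot na dl; rewrite rv_dotNl oppr_ge0 leNgt al.
Qed.

Lemma dominant_Uv l : dominant l -> Uv l \subset U.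
Proof. by move=> dl; rewrite -(xgen_U Phi); apply: xgenS => a; apply: dominant_pos. Qed.

Lemma BE : B :=: U <*> H.
Proof. by rewrite -(sdprodWY (bn_split D)). Qed.

Lemma dominant_Pv l : dominant l -> B \subset Pv l.
Proof.
move=> dl; rewrite BE /= join_subG joing_subl andbT.
apply: subset_trans (joing_subr _ _); rewrite -(xgen_U Phi).
by apply: xgenS => a ra /(height_pos ra)/nonneg_dot; apply.
Qed.

Lemma exists_dominant_conj l :
  exists2 k, k \in N & dominant (l ** (coset H k)^-1)%R.
Proof.
have [w Ww dw] := exists_dominant l; have Ww' : w^-1 \in W by rewrite groupV.
by have [k Nk kE] := W_rep Ww'; exists k => //; rewrite kE invgK.
Qed.

(** Together with [conj_Uv] this places [Uv l] and [Uv (- l)] in [U :^ k] and [U :^ (w0 * k)], which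
    meet trivially. *)
Lemma dominantN_conj l k : k \in N -> dominant (l ** (coset H k)^-1)%R ->
  dominant (- l ** (coset H (w0 * k))^-1)%R.
Proof.
have [Nw0 lw0] := w0_repP Phi => Nk dk s Ss.
have [Ww Wk] := (coset_in_W Nw0, coset_in_W Nk).
rewrite cosetM // invMg act_mul ?groupV // -[rv_dot _ _]opprK -rv_dotNr.
rewrite mulNmx mulNmx opprK -dot_actl // -rv_dotNl.
have ra := root_act Ww (root_simple Phi Ss).
apply: nonneg_dot => //; apply: height_pos; first exact: root_opp.
by rewrite rv_dotNl oppr_gt0 lw0.
Qed.

Lemma conj_Uv l k : k \in N -> dominant (l ** (coset H k)^-1)%R -> Uv l \subset U :^ k.
Proof.
move=> Nk dl; rewrite -sub_conjgV UvJ ?groupV // cosetVN //.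
exact: dominant_Uv.
Qed.

Lemma conj_Pv l k : k \in N -> dominant (l ** (coset H k)^-1)%R -> B :^ k \subset Pv l.
Proof.
move=> Nk dl; rewrite sub_conjg PvJ ?groupV // cosetVN //.
exact: dominant_Pv.
Qed.

Lemma Uv_pgroup l : p.-group (Uv l).
Proof.
have [k Nk dk] := exists_dominant_conj l.
by apply: pgroupS (conj_Uv Nk dk) _; rewrite pgroupJ bn_pgroup.
Qed.

(** The product of [T] and [U :^ k] is a [p]-group. A proper subgroup of it is properly contained in
    its normalizer, but the normalizer of [U :^ k] in [G] lies in [B :^ k], all of whose
    [p]-subgroups are in [U :^ k]. *)
Lemma p_normal_sub_U (T M : {group gT}) k : k \in N -> M \subset G ->
  B :^ k \subset M -> T \subset M -> M \subset 'N(T) -> p.-group T ->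
  T \subset U :^ k.
Proof.
move=> Nk sMG sBM sTM nTM pT.
have sUM : U :^ k \subset M by apply: subset_trans sBM; rewrite conjSg sUB.
have pE : p.-group (T <*> U :^ k).
  rewrite norm_joinEr ?(subset_trans sUM) //.
  by rewrite pgroupM pT pgroupJ bn_pgroup.
have sEG : T <*> U :^ k \subset G.
  by rewrite join_subG !(subset_trans _ sMG).
suff -> : U :^ k = T <*> U :^ k by rewrite joing_subl.
apply/eqP/negPn/negP => neq.
have := nilpotent_proper_norm (pgroup_nil pE) _.
move/(_ (U :^ k)%G); rewrite properEneq neq joing_subr => /(_ isT).
rewrite properE => /andP[_] /negP; apply.
have : 'N_(T <*> U :^ k)(U :^ k) \subset B :^ k.
  apply: (@subset_trans _ _ ('N_G(U) :^ k)); last by rewrite conjSg (normU_sub Phi).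
  rewrite conjIg -normJ (conjGid (subsetP (sNG D) k Nk)).
  by rewrite setSI.
apply: p_sub_U; exact: pgroupS (subsetIl _ _) pE.
Qed.

(* Since M normalizes both Uv l and Uv (- l), T lies in two opposite
   conjugates of U. *)
Lemma Lv_p_trivial l (M T : {group gT}) : Lv l \subset M -> M \subset G ->
  M \subset 'N(Uv l) -> M \subset 'N(Uv (- l)%R) ->
  T \subset M -> M \subset 'N(T) -> p.-group T -> T :=: 1.
Proof.
move=> sLM sMG nUM nUM' sTM nTM pT.
have half l' k : k \in N -> dominant (l' ** (coset H k)^-1)%R ->
    Lv l' \subset M -> M \subset 'N(Uv l') -> T \subset U :^ k.
  move=> Nk dk sL'M nU'M.
  apply: (@subset_trans _ _ (Uv l' <*> T)); first exact: joing_subr.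
  apply: (@p_normal_sub_U [group of Uv l' <*> T] [group of Uv l' <*> M]) => //.
  - by rewrite join_subG sUvG.
  - apply: subset_trans (conj_Pv Nk dk) _.
    by rewrite PvE mul_subG ?joing_subl // (subset_trans sL'M) ?joing_subr.
  - by rewrite genS // setUS.
  - rewrite /= join_subG; apply/andP; split.
      exact: subset_trans (joing_subl _ T) (normG _).
    by rewrite normsY.
  - by rewrite /= norm_joinEr ?(subset_trans sTM) // pgroupM Uv_pgroup.
have [k Nk dk] := exists_dominant_conj l.
have [Nw0 _] := w0_repP Phi.
have T1 := half _ _ Nk dk sLM nUM.
have T2 : T \subset U :^ (w0 * k).
  apply: half nUM'; [exact: groupM | exact: dominantN_conj | by rewrite LvN].
apply/trivgP; rewrite -(conjs1g k) -(capU_longest Phi) conjIg -conjsgM.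
by rewrite subsetI T1.
Qed.

Lemma LvUv1 l : Uv l :&: Lv l = 1.
Proof.
apply: (Lv_p_trivial (l := l) (M := Lv l) (T := [group of Uv l :&: Lv l])) => //=.
- exact: sLvG.
- exact: Lv_normUv.
- exact: Lv_normUvN.
- exact: subsetIr.
- by rewrite normsI ?normG ?Lv_normUv.
exact: pgroupS (subsetIl _ _) (Uv_pgroup l).
Qed.

Lemma sdPv l : Uv l ><| Lv l = Pv l.
Proof. by rewrite sdprodE ?Lv_normUv ?LvUv1 // -PvE. Qed.

Lemma Uv_normal l : Uv l <| Pv l.
Proof. by have /sdprod_context[] := sdPv l. Qed.

(** By the modular law the core is the product of [Uv l] and its intersection with [Lv l]. The
    latter is a normal [p]-subgroup of [Lv l], hence trivial. *)
Lemma pcore_Pv l : 'O_p(Pv l) = Uv l.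
Proof.
have sUO : Uv l \subset 'O_p(Pv l) by apply: pcore_max; rewrite ?Uv_pgroup ?Uv_normal.
have nLO : Lv l \subset 'N('O_p(Pv l)).
  by apply: subset_trans (sLvPv l) _; rewrite normal_norm ?pcore_normal.
have O1 : 'O_p(Pv l) :&: Lv l = 1.
  apply: (Lv_p_trivial (l := l) (M := Lv l) (T := ('O_p(Pv l) :&: Lv l)%G)) => //=.
  - exact: sLvG.
  - exact: Lv_normUv.
  - exact: Lv_normUvN.
  - exact: subsetIr.
  - by rewrite normsI ?normG.
  exact: pgroupS (subsetIl _ _) (pcore_pgroup _ _).
have := group_modl (Lv l) sUO; rewrite -PvE [Lv l :&: _]setIC O1 mulg1 => ->.
by rewrite (setIidPr (pcore_sub _ _)).
Qed.

(** The intersection [T] is normalized by [Lv l], so it generates with [Uv l] a normal [p]-subgroup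
    of [Pv l] and lies in [Uv l]. But [Uv l] and [Uv (- l)] are contained in opposite conjugates of
    [U]. *)
Lemma capPvUvN l : Pv l :&: Uv (- l)%R = 1.
Proof.
set T := [group of Pv l :&: Uv (- l)%R].
have sTP : T \subset Pv l by apply: subsetIl.
have nLT : Lv l \subset 'N(T).
  by rewrite normsI ?Lv_normUvN // (subset_trans (sLvPv l)) ?normG.
have nUT : T \subset 'N(Uv l).
  exact: subset_trans sTP (normal_norm (Uv_normal l)).
have sTU : T \subset Uv l.
  rewrite -pcore_Pv; apply: subset_trans (joing_subr (Uv l) T) _.
  apply: pcore_max.
    by rewrite /= norm_joinEr // pgroupM Uv_pgroup (pgroupS (subsetIr _ _)) ?Uv_pgroup.
  rewrite /normal join_subG sUvPv sTP /= {1}PvE mul_subG //.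
    exact: subset_trans (joing_subl _ T) (normG _).
  by rewrite normsY ?Lv_normUv.
have [k Nk dk] := exists_dominant_conj l; have [Nw0 _] := w0_repP Phi.
apply/trivgP; rewrite -(conjs1g k) -(capU_longest Phi) conjIg -conjsgM subsetI.
rewrite (subset_trans sTU (conj_Uv Nk dk)) /=.
apply: subset_trans (subsetIr _ _) _; apply: conj_Uv; rewrite ?groupM //.
exact: dominantN_conj.
Qed.

(** This recovers signs of scalar products from the group, so that inclusions of subgroups become
    conditions on vectors. *)
Lemma root_in_Pv l s n : s \in S -> n \in N ->
  (X s n \subset Pv l) = (0 <= rv_dot (rt s n) l)%R.
Proof.
move=> Ss Nn; apply/idP/idP => [sX|]; last first.
  by move=> a0; apply: subset_trans (joing_subr _ _); apply: mem_xgen.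
rewrite leNgt; apply/negP=> a0.
have sX' : X s n \subset Uv (- l)%R by apply: mem_xgen; rewrite ?rv_dotNr ?oppr_gt0.
have : X s n \subset Pv l :&: Uv (- l)%R by rewrite subsetI sX.
by rewrite capPvUvN => /trivgP/eqP; apply/negP; apply: root_neq1.
Qed.

Lemma root_in_Lv l s n : s \in S -> n \in N -> rv_dot (rt s n) l = 0%R ->
  X s n \subset Lv l.
Proof.
move=> Ss Nn a0; apply: subset_trans (joing_subr _ _).
by apply: mem_xgen => //; rewrite a0.
Qed.

(** Apply [root_in_Pv] to a root and to its negative. *)
Lemma Lv_in_Pv l t : Lv l \subset Pv t ->
  forall a, is_root a -> rv_dot a l = 0%R -> rv_dot a t = 0%R.
Proof.
move=> sLP _ [s [w [Ss Ww ->]]]; have [n Nn <-] := W_rep Ww; rewrite -/(rt s n) => a0.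
apply/eqP; rewrite eq_le -oppr_ge0 -rv_dotNl -root_at_opp //.
have Ns := repr_in_N (simple_in_W Ss).
rewrite -!root_in_Pv ?groupM // !(subset_trans _ sLP) ?root_in_Lv ?groupM //.
by rewrite root_at_opp // rv_dotNl a0 oppr0.
Qed.

Lemma Lv_sub l t : (forall a, is_root a -> rv_dot a l = 0%R -> rv_dot a t = 0%R) ->
  Lv l \subset Lv t.
Proof.
move=> lt; rewrite /= genS // setUS //; apply: xgenS => a ra /eqP/(lt a ra)->.
exact: eqxx.
Qed.

End VectorSubgroups.

(** * Comparison with the standard subgroups, and perturbation of vectors *)

Section StandardSubgroups.

Variables (R : realType) (gT : finGroupType) (p : nat) (G : {group gT}).
Variables (D : split_BN_pair p G) (Phi : root_system R D).
Hypothesis hcomm : commutator_relations Phi.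

Local Notation B := (bnB D).
Local Notation N := (bnN D).
Local Notation U := (bnU D).
Local Notation H := (bnH D).
Local Notation S := (bnS D).
Local Notation W := (weyl_group D).
Local Notation rho := (rs_repr Phi).
Local Notation alpha := (rs_simple Phi).
Local Notation vec := 'rV[R]_(rs_rank Phi).
Local Notation "v ** w" := (mulmx v (rho w%g))
  (at level 40, left associativity) : ring_scope.
Local Notation X := (root_subgroup Phi).
Local Notation rt := (root_at Phi).
Implicit Types (I J : {set coset_of H}) (l m s t : vec).

(** Conjugation by the inverse of [w0 * repr v] keeps the root positive, so [root_pos_sub] gives
    both inclusions required by the definition of the simple root subgroup. *)
Lemma root_sub_simple u n v : u \in S -> n \in N -> v \in S -> rt u n = alpha v ->
  X u n \subset simple_root_subgroup Phi v.
Proof.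
move=> Su Nn Sv uv; have [Nw0 lw0] := w0_repP Phi.
have [Wv Wn] := (simple_in_W Sv, coset_in_W Nn).
rewrite subsetI root_pos_sub ?uv ?dot_height ?ltr01 //=.
rewrite -sub_conjgV root_subgroupJ root_pos_sub //.
  by rewrite groupM // groupV groupM // repr_in_N.
rewrite root_atM ?groupV ?groupM ?repr_in_N // cosetVN ?groupM ?repr_in_N //.
rewrite cosetM ?repr_in_N // coset_reprK invMg (simpleV Sv) uv.
rewrite act_mul ?groupV ?coset_in_W // simple_reflects // mulNmx rv_dotNl oppr_gt0.
by apply: (longestV _ lw0) => //; apply: coset_in_W.
Qed.

Lemma root_subgroup_eq u n v k : u \in S -> n \in N -> v \in S -> k \in N ->
  rt u n = rt v k -> X u n = X v k.
Proof.
have sub u1 n1 v1 k1 : u1 \in S -> n1 \in N -> v1 \in S -> k1 \in N ->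
    rt u1 n1 = rt v1 k1 -> X u1 n1 \subset X v1 k1.
  move=> Su Nn Sv Nk uv; rewrite -sub_conjgV root_subgroupJ.
  apply: root_sub_simple; rewrite ?groupM ?groupV //.
  by rewrite root_atM ?groupV // uv cosetVN // act_K ?coset_in_W.
by move=> Su Nn Sv Nk uv; apply/eqP; rewrite eqEsubset !sub.
Qed.

Definition zero_set l : {set coset_of H} := [set u in S | rv_dot (alpha u) l == 0%R].

Lemma zero_setS l : zero_set l \subset S.
Proof. by apply/subsetP=> u; rewrite inE => /andP[]. Qed.

Lemma zero_set_fix l w : w \in <<zero_set l>> -> (l ** w)%R = l.
Proof.
by apply: parabolic_fix (zero_setS l) _ => u; rewrite inE => /andP[_ /eqP].
Qed.

Lemma exists_zero_set J : J \subset S -> exists2 l, dominant l & zero_set l = J.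
Proof.
move=> sJS; have [l lE] := dual_vector Phi (fun u => if u \in J then 0 else 1)%R.
exists l => [u Su|]; first by rewrite lE //; case: ifP; rewrite ?ler01.
apply/setP=> u; rewrite inE; apply/andP/idP => [[Su]|Ju].
  by rewrite lE //; case: ifP => // _; rewrite oner_eq0.
by have Su := subsetP sJS u Ju; rewrite lE // Ju eqxx.
Qed.

(** By [root_parabolic], the roots orthogonal to [l] are those of the standard reflection subgroup,
    and root subgroups depend only on their roots. *)
Lemma std_leviE l : dominant l -> std_levi Phi (zero_set l) = Lv l.
Proof.
move=> dl; set J := zero_set l; apply/eqP; rewrite eqEsubset; apply/andP; split.
  rewrite gen_subG subUset joing_subl /=; apply/bigcupsP=> u Ju.
  apply/bigcupsP=> n; rewrite inE => /andP[Nn Jn].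
  move: (Ju); rewrite inE => /andP[Su /eqP ul].
  apply: root_in_Lv => //.
  by rewrite -[l](zero_set_fix Jn) dot_act ?coset_in_W.
rewrite /= join_subG sub_gen ?subsetUl //=.
apply: (xgen_sub (M := [group of std_levi Phi J])) => u n Su Nn /eqP un.
have lJ : {in S, forall v, (rv_dot (alpha v) l == 0%R) = (v \in J)}.
  by move=> v Sv; rewrite inE Sv.
have [v [w [Jv Jw vE]]] := root_parabolic (zero_setS l) (root_at_root Phi Su Nn) dl lJ un.
have [k Nk kE] := W_rep (subsetP (gen_simple_sub (zero_setS l)) w Jw).
have Sv := subsetP (zero_setS l) v Jv.
rewrite (root_subgroup_eq Su Nn Sv Nk) ?vE ?/root_at ?kE //.
rewrite sub_gen // subsetU // orbC (bigcup_max v) // (bigcup_max k) //.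
by rewrite inE Nk kE.
Qed.

(** The left side meets [Uv l] in a normal [p]-subgroup, which [Lv_p_trivial] kills; the modular law
    does the rest. This description makes it easy to show that elements of [N] lie in [Lv l]. *)
Lemma Pv_normUvN l : Pv l :&: 'N(Uv (- l)%R) = Lv l.
Proof.
set M := (Pv l :&: 'N(Uv (- l)%R))%G.
have sLM : Lv l \subset M by rewrite subsetI sLvPv // Lv_normUvN.
have M1 : Uv l :&: M = 1.
  apply: (Lv_p_trivial (l := l) hcomm (M := M) (T := (Uv l :&: M)%G)) => //.
  - exact: subset_trans (subsetIl _ _) (sPvG _).
  - exact: subset_trans (subsetIl _ _) (normal_norm (Uv_normal hcomm l)).
  - exact: subsetIr.
  - exact: subsetIr.
  - rewrite normsI ?normG //.
    exact: subset_trans (subsetIl _ _) (normal_norm (Uv_normal hcomm l)).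
  exact: pgroupS (subsetIl _ _) (Uv_pgroup l).
have := group_modr (Uv l) sLM; rewrite -PvE // [M :&: Uv l]setIC M1 mul1g => ->.
by apply/esym/setIidPl; apply: subsetIl.
Qed.

(** A nontrivial element of the root subgroup of [- alpha u] lies in [Pv l] but not in [B], hence in
    the cell of [u]. Since [B] lies in [Pv l], so does the representative. *)
Lemma simple_rep_Pv l u : dominant l -> u \in zero_set l -> repr u \in Pv l.
Proof.
move=> dl Ju; move: (Ju); rewrite inE => /andP[Su /eqP ul].
have Wu := simple_in_W Su; have Nk := repr_in_N Wu.
set k := repr u in Nk *; have kE : coset H k = u by rewrite coset_reprK.
have kr : rt u k = (- alpha u)%R by rewrite /root_at kE simple_reflects.
have sX : X u k \subset Pv l.
  by rewrite root_in_Pv // kr rv_dotNl ul oppr0.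
have XU : X u k :&: U = 1.
  by apply: root_neg_capU => //; rewrite kr rv_dotNl dot_height // oppr_lt0 ltr01.
have /trivgPn[x Xx x1] : (simple_root_subgroup Phi u :^ k) != 1 := root_neq1 Phi k Su.
have Bx : x \notin B.
  apply: contra x1 => Bx; rewrite -in_set1 -[[set 1]]/(1%g : {set gT}) -XU inE Xx /=.
  have : (X u k :&: B)%G \subset U; last by move/subsetP; apply; rewrite inE Xx.
  apply: p_sub_U1; rewrite ?subsetIr //; apply: pgroupS (subsetIl _ _) _.
  by rewrite /root_subgroup pgroupJ simple_root_pgroup.
have kc : k \in cell u by rewrite -kE cell_id.
have kc' : k^-1 \in cell u by rewrite -(simpleV Su) cellV.
have By : x ^ k^-1 \in B.
  rewrite -mem_conjg; apply: (subsetP _ _ Xx); rewrite conjSg.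
  exact: subset_trans (simple_root_sub _ _) (sUB D).
have xE : x = k^-1 * ((x ^ k^-1) * k) by rewrite -conjgE conjgKV.
have : x \in cell (u * u) \/ x \in cell u.
  by rewrite xE; apply: cell_mul => //; rewrite cell_mull.
rewrite simple_mul_self // cell1 (negPf Bx) => -[//|].
rewrite -kE => /(cell_rep Nk)[b [c [Bb Bc xbc]]].
have -> : k = b^-1 * x * c^-1 by rewrite xbc !mulgA mulVg mul1g mulgK.
have sBP := subsetP (dominant_Pv dl).
have [Pb Px Pc] := And3 (sBP b Bb) (subsetP sX x Xx) (sBP c Bc).
by rewrite !groupM ?groupV.
Qed.

Lemma N_zero_Lv l n : dominant l -> n \in N -> coset H n \in <<zero_set l>> ->
  n \in Lv l.
Proof.
move=> dl Nn Jn; rewrite -Pv_normUvN //; apply/setIP; split; last first.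
  by apply/normP; rewrite UvJ // mulNmx zero_set_fix.
have sJ : <<zero_set l>> \subset (N :&: Pv l) / H.
  rewrite gen_subG; apply/subsetP=> u Ju.
  have Wu := simple_in_W (subsetP (zero_setS l) u Ju).
  by rewrite -[u]coset_reprK mem_quotient // inE repr_in_N // simple_rep_Pv.
have /morphimP[k _ /setIP[Nk Pk] nk] := subsetP sJ _ Jn.
have [h Hh ->] := cosetN_eq Nn Nk nk.
by rewrite groupM // (subsetP (joing_subl _ _)).
Qed.

Lemma parabolic_ofP J x :
  reflect (exists2 w, w \in <<J>> /\ w \in W & x \in cell w) (x \in std_parabolic_of B N J).
Proof.
apply: (iffP mulsgP) => [[y c /mulsgP[b n Bb]]|[w [Jw Ww]]].
  rewrite inE => /andP[Nn Jn] -> Bc ->; exists (coset H n).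
    by rewrite coset_in_W.
  by rewrite cell_bimul // cell_id.
case/cellP=> b [n [c [Bb Nn Bc nw ->]]]; exists (b * n) c => //.
by rewrite mem_mulg // inE Nn nw.
Qed.

Lemma parabolic_of_group J : J \subset S -> group_set (std_parabolic_of B N J).
Proof.
move=> sJS; have sJW := subsetP (gen_simple_sub sJS).
have closed w : w \in <<J>> -> forall x y, x \in cell w ->
    y \in std_parabolic_of B N J -> x * y \in std_parabolic_of B N J.
  move: w; apply: gen_mull_ind => [|u w Ju Jw IH] x y.
    rewrite cell1 => Bx /parabolic_ofP[v Jv vy]; apply/parabolic_ofP.
    by exists v => //; rewrite cell_mull.
  have Su := subsetP sJS u Ju; have Wu := simple_in_W Su.
  have [k Nk kE] := W_rep Wu; have [n Nn nE] := W_rep (sJW w Jw).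
  rewrite -kE -nE -cosetM // => /cell_rep; rewrite groupM // => /(_ isT).
  case=> b [c [Bb Bc ->]] Py.
  have : n * c * y \in std_parabolic_of B N J.
    by apply: IH => //; rewrite cell_mulr // -nE cell_id.
  case/parabolic_ofP=> v [Jv Wv] vy.
  have bk : b * k \in cell u by rewrite cell_mull // -kE cell_id.
  have -> : b * (k * n) * c * y = b * k * (n * c * y) by rewrite !mulgA.
  have Ju' : u \in <<J>> by rewrite mem_gen.
  case: (cell_mul Su Wv bk vy) => xy; apply/parabolic_ofP; last by exists v.
  by exists (u * v) => //; split; apply: groupM.
apply/group_setP; split=> [|x y /parabolic_ofP[w [Jw _]]]; last exact: closed.
by apply/parabolic_ofP; exists 1; rewrite ?group1 ?cell1.
Qed.

Lemma std_parabolicE l : dominant l -> std_parabolic (zero_set l) = Pv l.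
Proof.
move=> dl; set J := zero_set l; rewrite /std_parabolic.
have sJS := zero_setS l.
apply/eqP; rewrite eqEsubset; apply/andP; split.
  rewrite !mul_subG ?dominant_Pv //; apply/subsetP=> n; rewrite inE => /andP[Nn Jn].
  by apply: (subsetP (sLvPv hcomm l)); apply: N_zero_Lv.
set E := Group (parabolic_of_group sJS).
have sBE : B \subset E.
  by apply/subsetP=> b Bb; apply/parabolic_ofP; exists 1; rewrite ?group1 ?cell1.
have sNE n : n \in N -> coset H n \in <<J>> -> n \in E.
  move=> Nn Jn; apply/parabolic_ofP; exists (coset H n); last exact: cell_id.
  by rewrite coset_in_W.
change (Pv l \subset E); rewrite PvE // mul_subG //.
  exact: subset_trans (dominant_Uv dl) (subset_trans (sUB D) sBE).
rewrite -std_leviE // gen_subG subUset (subset_trans (sHB D)) //=.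
apply/bigcupsP=> u Ju; apply/bigcupsP=> n; rewrite inE => /andP[Nn Jn].
rewrite /root_subgroup sub_conjg -/(gval E) (conjGid (G := E)) ?groupV ?sNE //.
exact: subset_trans (simple_root_sub _ _) (subset_trans (sUB D) sBE).
Qed.

(** For an element [b * n * c] of [Lv l] in the Bruhat form of [Pv t], [n] already lies in [Lv l].
    Splitting [b] and [c] along [Uv l] and [B :&: Lv l], the parts in [Uv l] combine to an element
    of [Uv l :&: Lv l], which is trivial. *)
Lemma parabolic_in_LvE l t : dominant l -> dominant t -> zero_set t \subset zero_set l ->
  std_parabolic_of (B :&: Lv l) (N :&: Lv l) (zero_set t) = Pv t :&: Lv l.
Proof.
move=> dl dt sIJ; apply/eqP; rewrite eqEsubset; apply/andP; split.
  rewrite !mul_subG ?setSI ?dominant_Pv //.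
  apply/subsetP=> n; rewrite 2!inE => /andP[/andP[Nn Ln] In].
  rewrite inE Ln andbT; apply: (subsetP (sLvPv hcomm t)); exact: N_zero_Lv.
have BE1 : B :=: Uv l * (B :&: Lv l).
  rewrite setIC group_modl ?(subset_trans (dominant_Uv dl) (sUB D)) // -PvE //.
  by apply/esym/setIidPr/dominant_Pv.
apply/subsetP=> x /setIP[]; rewrite -std_parabolicE //.
case/mulsgP=> y c /mulsgP[b n Bb]; rewrite inE => /andP[Nn In] -> Bc -> Lx.
have Ln : n \in Lv l by apply: N_zero_Lv; rewrite // (subsetP (genS sIJ)).
move: Bb; rewrite {1}BE1 => /mulsgP[u b' Uu /setIP[Bb' Lb'] bE].
have : c^-1 \in Uv l * (B :&: Lv l) by rewrite -BE1 groupV.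
case/mulsgP=> v c' Uv1 /setIP[Bc' Lc'] cE.
have {}cE : c = c'^-1 * v^-1 by rewrite -invMg -cE invgK.
have Lz : b' * n * c'^-1 \in Lv l by rewrite !groupM ?groupV.
have xE : b * n * c = u * (v^-1 ^ (b' * n * c'^-1)^-1) * (b' * n * c'^-1).
  by rewrite bE cE -[RHS]mulgA -conjgCV !mulgA.
have u1 : u * (v^-1 ^ (b' * n * c'^-1)^-1) = 1.
  apply/set1P; rewrite -[[set 1]]/(1%g : {set gT}) -(LvUv1 hcomm l) inE.
  rewrite -(groupMr _ Lz) -xE Lx andbT groupM // memJ_norm ?groupV //.
  by rewrite (subsetP (Lv_normUv hcomm l)) ?groupV.
rewrite xE u1 mul1g; apply: mem_mulg; last by rewrite inE !groupV Bc'.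
by apply: mem_mulg; rewrite !inE ?Bb' ?Nn ?Ln.
Qed.

Lemma parabolic_of_conj (B' N' : {group gT}) I k : k \in N -> N' \subset N ->
  std_parabolic_of B' N' I :^ k =
  std_parabolic_of (B' :^ k) (N' :^ k) (I :^ coset H k).
Proof.
move=> Nk sN'N; rewrite /std_parabolic_of !conjsMg; congr (_ * _ * _).
apply/setP=> n; rewrite mem_conjg !inE genJ.
rewrite [n \in N' :^ k]mem_conjg.
case: (boolP (n ^ k^-1 \in N')) => //= N'n.
have nHk := subsetP (nHN D) k Nk; have nHn := subsetP (nHN D) _ (subsetP sN'N _ N'n).
have e : coset H n = coset H (n ^ k^-1) ^ coset H k.
  by rewrite -{1}(conjgKV k n); apply: morphJ.
by rewrite e memJ_conjg.
Qed.

(* The sign vector of t on the roots is that of m + epsilon s. *)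
Definition lex m s t : Prop := forall a, is_root (Phi := Phi) a ->
  ((0 < rv_dot a m)%R -> (0 < rv_dot a t)%R) /\
  (rv_dot a m = 0%R -> (0 < rv_dot a t)%R = (0 < rv_dot a s)%R).

Lemma lex_exists m s : exists t, lex m s t.
Proof.
pose q (x : coset_of H * coset_of H) : R :=
  (let a := alpha x.1 ** x.2 in `|rv_dot a s| / `|rv_dot a m|)%R.
(* [M] exceeds every quotient [q], so [M *: m] dominates [s] on all roots not orthogonal to [m]. For
   the orthogonal ones division by zero gives the harmless value 0. *)
pose M : R := (1 + \sum_(x in setX S W) q x)%R.
exists (M *: m + s)%R => a [u [w [Su Ww aE]]].
rewrite rv_dotDr rv_dotZr; split=> [am|->]; last by rewrite mulr0 add0r.
have lt : (`|rv_dot a s| < M * rv_dot a m)%R.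
  rewrite -ltr_pdivrMr // -[X in (_ / X < _)%R]gtr0_norm // /M.
  have -> : (`|rv_dot a s| / `|rv_dot a m|)%R = q (u, w) by rewrite aE.
  rewrite (bigD1 (u, w)) /=; last by rewrite inE Su.
  rewrite [X in (_ < X)%R]addrCA ltrDl ltr_pwDl ?ltr01 //.
  by apply: sumr_ge0 => x _; rewrite divr_ge0.
by rewrite -ltrBlDr sub0r; apply: le_lt_trans lt; rewrite -normrN ler_norm.
Qed.

Section Lex.

Variables m s t : vec.
Hypothesis lt : lex m s t.

Lemma lex_neg a : is_root (Phi := Phi) a -> (rv_dot a m < 0)%R -> (rv_dot a t < 0)%R.
Proof.
move=> ra; have [h _] := lt (root_opp ra).
by move: h; rewrite !rv_dotNl !oppr_gt0.
Qed.

Lemma lex_ge0 a : is_root (Phi := Phi) a -> (0 <= rv_dot a t)%R -> (0 <= rv_dot a m)%R.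
Proof. by move=> ra; rewrite !leNgt; apply: contra; apply: lex_neg. Qed.

Lemma lex_eq0 a : is_root (Phi := Phi) a -> rv_dot a t = 0%R -> rv_dot a m = 0%R.
Proof.
move=> ra t0; apply/eqP; rewrite eq_le -oppr_ge0 -rv_dotNl.
by rewrite !lex_ge0 ?rv_dotNl ?t0 ?oppr0 //; apply: root_opp.
Qed.

Lemma lex_zero_ge0 a : is_root (Phi := Phi) a -> rv_dot a m = 0%R ->
  (0 <= rv_dot a t)%R = (0 <= rv_dot a s)%R.
Proof.
move=> ra m0; have [_ h] := lt (root_opp ra); move: h.
by rewrite !rv_dotNl m0 oppr0 !oppr_gt0 !leNgt => /(_ erefl)->.
Qed.

Lemma lex_sUv : Uv m \subset Uv t.
Proof. by apply: xgenS => a ra; case: (lt ra). Qed.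

Lemma lex_sLv : Lv t \subset Lv m.
Proof. by apply: Lv_sub => a; apply: lex_eq0. Qed.

Lemma lex_sPv : Pv t \subset Pv m.
Proof. by rewrite genS // setUS //; apply: xgenS => a; apply: lex_ge0. Qed.

Lemma lex_PvE : Uv m * (Pv t :&: Lv m) = Pv t.
Proof.
rewrite setIC group_modl ?(subset_trans lex_sUv (sUvPv hcomm t)) // -PvE //.
by apply/setIidPr/lex_sPv.
Qed.

Lemma lex_UvE : Uv m * (Uv t :&: Lv m) = Uv t.
Proof.
rewrite setIC group_modl ?lex_sUv // -PvE //.
by apply/setIidPr; apply: subset_trans (sUvPv hcomm t) lex_sPv.
Qed.

(** The right side depends on [m] only through the roots orthogonal to it, which allows [m] to be
    exchanged. The group [A] on the right lies in [Lv m] and [Pv t] lies in [Uv m * A], so the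
    modular law applies because [Uv m] meets [Lv m] trivially. *)
Lemma lex_cap_Pv : Pv t :&: Lv m =
  H <*> xgen (Phi := Phi) (fun a => (rv_dot a m == 0) && (0 <= rv_dot a s))%R.
Proof.
set A := (H <*> xgen_group (Phi := Phi)
  (fun a => (rv_dot a m == 0) && (0 <= rv_dot a s))%R)%G.
have sAL : A \subset Lv m.
  by rewrite genS // setUS //; apply: xgenS => a _ /andP[].
have sAP : A \subset Pv t.
  rewrite genS // setUS //; apply: xgenS => a ra /andP[/eqP m0].
  by rewrite lex_zero_ge0.
have sPA : Pv t \subset Uv m * A.
  rewrite -norm_joinEr ?(subset_trans sAL (Lv_normUv hcomm m)) //.
  rewrite join_subG; apply/andP; split.
    exact: subset_trans (joing_subl _ _) (joing_subr _ _).
  apply: (xgen_sub (M := [group of Uv m <*> A])) => u n Su Nn a0.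
  have ra := root_at_root Phi Su Nn.
  have := lex_ge0 ra a0; rewrite le_eqVlt eq_sym => /orP[m0|m0].
    apply: subset_trans (joing_subr _ _); apply: subset_trans (joing_subr _ _).
    by apply: mem_xgen => //; rewrite m0 -lex_zero_ge0 //; apply/eqP.
  by apply: subset_trans (joing_subl _ _); apply: mem_xgen.
apply/eqP; rewrite eqEsubset subsetI sAP sAL !andbT.
have := setSI (Lv m) sPA; rewrite [Uv m * A :&: _]setIC -group_modr //.
by rewrite [Lv m :&: _]setIC LvUv1 // mul1g.
Qed.

Lemma lex_cap_Uv : Uv t :&: Lv m \subset Uv s.
Proof.
set A := xgen_group (Phi := Phi) (fun a => (rv_dot a m == 0) && (0 < rv_dot a s))%R.
have sAL : A \subset Lv m.
  by apply: subset_trans (joing_subr _ _); apply: xgenS => a _ /andP[].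
have sUA : Uv t \subset Uv m * A.
  rewrite -norm_joinEr ?(subset_trans sAL (Lv_normUv hcomm m)) //.
  apply: (xgen_sub (M := [group of Uv m <*> A])) => u n Su Nn a0.
  have ra := root_at_root Phi Su Nn.
  have := lex_ge0 ra (ltW a0); rewrite le_eqVlt eq_sym => /orP[m0|m0].
    apply: subset_trans (joing_subr _ _); apply: mem_xgen => //.
    by have [_ <-] := lt ra; rewrite ?m0 //; apply/eqP.
  by apply: subset_trans (joing_subl _ _); apply: mem_xgen.
have := setSI (Lv m) sUA; rewrite [Uv m * A :&: _]setIC -group_modr //.
rewrite [Lv m :&: _]setIC LvUv1 // mul1g => /subset_trans; apply.
by apply: xgenS => a _ /andP[].
Qed.

Lemma lex_sdprod : (Uv t :&: Lv m) ><| Lv t = Pv t :&: Lv m.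
Proof.
rewrite sdprodE.
- have := group_modr (Uv t) lex_sLv; rewrite -PvE // => e.
  by rewrite [RHS]setIC -e [Lv m :&: _]setIC.
- by rewrite normsI ?Lv_normUv // (subset_trans lex_sLv) ?normG.
by apply/trivgP; rewrite -(LvUv1 hcomm t) setSI ?subsetIl.
Qed.

(** The core generates with [Uv m] a normal [p]-subgroup of [Pv t], which is therefore contained in
    [Uv t] by [pcore_Pv]. *)
Lemma lex_pcore : 'O_p(Pv t :&: Lv m) = Uv t :&: Lv m.
Proof.
apply/eqP; rewrite eqEsubset; apply/andP; split; last first.
  apply: (pcore_max (G := (Pv t :&: Lv m)%G)).
    exact: pgroupS (subsetIl _ _) (Uv_pgroup t).
  by have /sdprod_context[] := lex_sdprod.
set O := 'O_p(Pv t :&: Lv m)%G.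
have sOQ : O \subset Pv t :&: Lv m by apply: pcore_sub.
have sOL : O \subset Lv m by apply: subset_trans sOQ (subsetIr _ _).
rewrite subsetI sOL andbT -pcore_Pv //.
apply: subset_trans (joing_subr (Uv m) O) _; apply: pcore_max.
  change (p.-group (Uv m <*> O)).
  rewrite norm_joinEr ?(subset_trans sOL (Lv_normUv hcomm m)) // pgroupM.
  by rewrite Uv_pgroup // pcore_pgroup.
apply/andP; split.
  rewrite join_subG (subset_trans lex_sUv (sUvPv hcomm t)).
  exact: subset_trans sOQ (subsetIl _ _).
rewrite -{1}lex_PvE mul_subG //.
  exact: subset_trans (joing_subl _ O) (normG _).
rewrite normsY //; first exact: subset_trans (subsetIr _ _) (Lv_normUv hcomm m).
exact: (normal_norm (pcore_normal _ (Pv t :&: Lv m)%G)).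
Qed.

End Lex.

End StandardSubgroups.

(** * Parabolic subgroups of Levi subgroups in terms of vectors *)

Section LeviGeometry.

Variables (R : realType) (gT : finGroupType) (p : nat) (G : {group gT}).
Variables (D : split_BN_pair p G) (Phi : root_system R D).
Hypothesis hcomm : commutator_relations Phi.

Local Notation B := (bnB D).
Local Notation N := (bnN D).
Local Notation H := (bnH D).
Local Notation rho := (rs_repr Phi).
Local Notation vec := 'rV[R]_(rs_rank Phi).
Local Notation "v ** w" := (mulmx v (rho w%g))
  (at level 40, left associativity) : ring_scope.
Implicit Types (I J : {set coset_of H}) (l m s t : vec).

Lemma parabolic_Pv (P : {set gT}) : is_parabolic D P -> exists m, P = Pv (Phi := Phi) m.
Proof.
case=> [J [n [sJS Nn ->]]]; have [l dl <-] := exists_zero_set Phi sJS.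
by exists (l ** coset H n)%R; rewrite std_parabolicE // PvJ.
Qed.

Lemma levi_Lv (L : {set gT}) : is_levi Phi L -> exists m, L = Lv (Phi := Phi) m.
Proof.
case=> [J [n [sJS Nn ->]]]; have [l dl <-] := exists_zero_set Phi sJS.
by exists (l ** coset H n)%R; rewrite std_leviE // LvJ.
Qed.

(** Since [Lv l] lies in [Pv m], the roots orthogonal to [l] are orthogonal to [m]. This gives one
    inclusion, and complements of the same subgroup have equal orders. *)
Lemma complement_Lv (O P L L' : {group gT}) m l :
    L = Lv l :> {set gT} -> L' = Lv m :> {set gT} -> P \subset Pv m ->
    O ><| L = P -> O ><| L' = P -> L = L' :> {set gT}.
Proof.
move=> LE L'E sPP sdL sdL'; apply/eqP; rewrite eqEcard.
have sLP : L \subset P by have /sdprod_context[] := sdL.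
rewrite -(leq_pmul2l (cardG_gt0 O)) (sdprod_card sdL) (sdprod_card sdL') leqnn andbT.
rewrite LE L'E; apply: Lv_sub; apply: Lv_in_Pv => //.
by rewrite -LE; apply: subset_trans sPP.
Qed.

(** A root positive on [l] involves a simple root outside [zero_set l], hence outside [zero_set t],
    and is therefore positive on [t]. *)
Lemma lex_self_zero l t : dominant (Phi := Phi) l -> dominant (Phi := Phi) t ->
  zero_set t \subset zero_set l -> lex l t t.
Proof.
move=> dl dt sIJ a ra; split=> // al.
have [c [c0 ac]] := height_pos ra (dominant_pos dl ra al).
rewrite lt_neqAle (nonneg_dot _ dt) ?andbT; last by exists c.
apply/eqP=> /esym a0; move: al; rewrite ac rv_dot_suml big1 ?ltxx // => u Su.
rewrite rv_dotZl; have [ul|ul] := eqVneq (rv_dot (rs_simple Phi u) l) 0%R.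
  by rewrite ul mulr0.
rewrite (nonneg_dot_eq0 c0 ac dt a0 Su) ?mul0r //.
apply: contra ul => ut; have : u \in zero_set t by rewrite inE Su.
by move/(subsetP sIJ); rewrite inE => /andP[].
Qed.

Lemma lexJ m s t n : n \in N -> lex m s t ->
  lex (m ** coset H n)%R (s ** coset H n)%R (t ** coset H n)%R.
Proof.
move=> Nn lt a ra; have Wn := coset_in_W Nn; have Wn' := groupVr Wn.
by have := lt _ (root_act Wn' ra); rewrite !dot_actl ?invgK.
Qed.

Lemma parabolic_in_lex (L Q : {group gT}) m : L = Lv m :> {set gT} ->
    is_parabolic_in Phi L Q ->
  exists s t, lex m s t /\ Q = Pv t :&: Lv m :> {set gT}.
Proof.
move=> LE [J [k [sJS Nk LE' [I [y [sIJ /setIP[Ny Ly] QE]]]]]].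
have sI'J : I :^ (coset H k)^-1 \subset J by rewrite sub_conjgV.
have [l dl lJ] := exists_zero_set Phi sJS.
have [i di iI] := exists_zero_set Phi (subset_trans sI'J sJS).
have lii : lex l i i by apply: lex_self_zero; rewrite // lJ iI.
pose s := (i ** coset H (k * y))%R; pose m' := (l ** coset H (k * y))%R.
have Nky : k * y \in N by rewrite groupM.
have LE1 : L = Lv m' :> {set gT}.
  by rewrite -LvJ // conjsgM -std_leviE // lJ -LE' conjGid.
have lss : lex m' s s by apply: lexJ.
have QE1 : Q = Pv s :&: Lv m' :> {set gT}.
  rewrite QE -PvJ // -LvJ // -conjIg conjsgM -parabolic_in_LvE // ?lJ ?iI //.
  rewrite (parabolic_of_conj (B :&: Lv l)%G (N' := (N :&: Lv l)%G)) ?subsetIl //.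
  rewrite conjsgKV !conjIg -std_leviE // lJ -LE'.
  by rewrite (conjGid Nk).
(* The vector to be perturbed is the given [m], not the [m'] that comes from the definition of [Q].
   Both define [L], hence have the same orthogonal roots, and [lex_cap_Pv] compares the two
   intersections. *)
have [t lt] := lex_exists m s; exists s, t; split=> //.
have e a : is_root (Phi := Phi) a -> (rv_dot a m == 0%R) = (rv_dot a m' == 0%R).
  move=> ra; apply/eqP/eqP; apply: Lv_in_Pv ra => //.
    by rewrite -LE LE1 sLvPv.
  by rewrite -LE1 LE sLvPv.
rewrite QE1 !(lex_cap_Pv hcomm lss) !(lex_cap_Pv hcomm lt); congr (_ <*> _).
by apply: eq_xgen => a ra; rewrite e.
Qed.

(** If the roots orthogonal to [t] are all orthogonal to its image [tn], then [n] normalizes [L0] by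
    comparison of orders. Otherwise the perturbation [c] of [t] towards [tn] defines a proper
    parabolic subgroup of [L0], whose radical lies in [Uv tn] by [lex_cap_Uv]. *)
Lemma Lv_radical_dichotomy (L0 : {group gT}) t n : L0 = Lv t :> {set gT} -> n \in N ->
  n \in 'N(L0) \/ exists Q1 : {group gT},
    [/\ is_parabolic_in Phi L0 Q1, Q1 \proper L0 & 'O_p(Q1) \subset Uv t :^ n].
Proof.
move=> LE Nn; pose tn := (t ** coset H n)%R.
have [[a [ra a0 an]]|no] := pselect (exists a,
    [/\ is_root (Phi := Phi) a, rv_dot a t = 0%R & (0 < rv_dot a tn)%R]); last first.
  left; rewrite LE inE; suff sL : Lv t \subset Lv t :^ n.
    by rewrite (_ : Lv t :^ n = Lv t) //; apply/esym/eqP; rewrite eqEcard sL cardJg /=.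
  rewrite LvJ //; apply: Lv_sub => a ra a0; apply/eqP.
  rewrite eq_le !leNgt; apply/andP; split; apply/negP=> an; apply: no.
    by exists a.
  exists (- a)%R; rewrite !rv_dotNl a0 oppr0 oppr_gt0; split=> //.
  exact: root_opp.
right; have [c lc] := lex_exists t tn; exists (Pv c :&: Lv t)%G; split; last first.
- rewrite (lex_pcore hcomm lc) UvJ //; exact: lex_cap_Uv lc.
- rewrite properE LE subsetIr /=; apply/negP; rewrite subsetI => /andP[sLP _].
  have [_ ca] := lc a ra.
  have := Lv_in_Pv hcomm sLP ra a0; move: an; rewrite -ca // => /[swap] ->.
  by rewrite ltxx.
(* To match the definition of [is_parabolic_in], move [c] to a dominant vector; the same element
   makes [t] dominant, because [c] is a perturbation of [t]. *)
have [k Nk dc] := exists_dominant_conj c.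
have [Wk Wk'] := (coset_in_W Nk, groupVr (coset_in_W Nk)).
have dt : dominant (Phi := Phi) (t ** (coset H k)^-1)%R.
  move=> u Su; have ra' := root_act Wk (root_simple Phi Su).
  rewrite -dot_actl // (lex_ge0 lc) // dot_actl //; exact: dc.
have sIJ : zero_set (c ** (coset H k)^-1)%R \subset zero_set (t ** (coset H k)^-1)%R.
  apply/subsetP=> u; rewrite !inE => /andP[Su]; rewrite Su -!dot_actl //=.
  move/eqP=> c0; apply/eqP; apply: (lex_eq0 lc) => //.
  exact: root_act (root_simple _ Su).
have LE' : L0 = std_levi Phi (zero_set (t ** (coset H k)^-1)%R) :^ k :> {set gT}.
  by rewrite std_leviE // LvJ // act_KV.
exists (zero_set (t ** (coset H k)^-1)%R), k; split=> //; first exact: zero_setS.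
exists (zero_set (c ** (coset H k)^-1)%R :^ coset H k), 1.
rewrite conjSg group1 conjsg1; split=> //.
have e : Pv c :&: Lv t =
    (Pv (c ** (coset H k)^-1)%R :&: Lv (t ** (coset H k)^-1)%R) :^ k.
  by rewrite conjIg PvJ // LvJ // !act_KV.
apply: (etrans e); rewrite -parabolic_in_LvE // LE' std_leviE //.
rewrite (parabolic_of_conj (B :&: Lv _)%G (N' := (N :&: Lv _)%G)) ?subsetIl //.
by rewrite !conjIg /= (conjGid Nk).
Qed.

(** This collects the group theory that the module argument uses. The witness is [V = Uv t], where
    [t] perturbs the vector of [P] and [Q = Pv t :&: Lv m]. *)
Lemma levi_radical (L0 L P Q : {group gT}) :
    is_levi Phi L0 -> is_levi Phi L -> is_parabolic D P -> is_parabolic_in Phi L Q ->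
    'O_p(P) ><| L = P -> 'O_p(Q) ><| L0 = Q ->
  exists V : {group gT}, [/\ 'O_p(P) * 'O_p(Q) = V, p.-group V, L0 \subset 'N(V),
    (exists2 k, k \in N & B :^ k \subset V * L0) &
    {in N, forall n, n \in 'N(L0) \/ exists Q1 : {group gT},
      [/\ is_parabolic_in Phi L0 Q1, Q1 \proper L0 & 'O_p(Q1) \subset V :^ n]}].
Proof.
move=> /levi_Lv[l0 L0E] /levi_Lv[l LE] /parabolic_Pv[m PE] hQ sdP sdQ.
have OPE : 'O_p(P) = Uv m by rewrite PE pcore_Pv.
have LmE : L = Lv m :> {set gT}.
  apply: (complement_Lv LE _ _ sdP) => //; first by rewrite PE.
  by change ('O_p(P) ><| Lv m = P); rewrite PE pcore_Pv // sdPv.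
have [s [t [lt QE]]] := parabolic_in_lex LmE hQ.
have OQE : 'O_p(Q) = Uv t :&: Lv m by rewrite QE (lex_pcore hcomm lt).
have L0tE : L0 = Lv t :> {set gT}.
  apply: (complement_Lv L0E _ _ sdQ) => //; first by rewrite QE subsetIl.
  change ('O_p(Q) ><| Lv t = Q).
  by rewrite QE (lex_pcore hcomm lt) (lex_sdprod hcomm lt).
exists (Uv t); split.
- by rewrite OPE OQE (lex_UvE hcomm lt).
- exact: Uv_pgroup.
- by rewrite L0tE Lv_normUv.
- have [k Nk dk] := exists_dominant_conj t; exists k => //.
  by rewrite L0tE -PvE // conj_Pv.
by move=> n; apply: Lv_radical_dichotomy.
Qed.

End LeviGeometry.

(** * Block matrices and Frobenius reciprocity for induced modules *)

Lemma sum_only (V : zmodType) (I : finType) (F : I -> V) i :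
  (forall j, j != i -> F j = 0%R) -> (\sum_j F j)%R = F i.
Proof. by move=> F0; rewrite (bigD1 i) //= big1 ?addr0. Qed.

Section InducedModule.

Variables (K : fieldType) (gT : finGroupType) (P G : {group gT}) (n : nat).
Hypothesis sPG : P \subset G.
Variable rP : mx_representation K P n.

Local Notation k := #|rcosets P G|.
Local Notation rX := (ind_repr sPG rP).
Local Notation dX := (\sum_(i < k) n)%N.
Local Notation rep := (@rcoset_rep gT P G).

Definition block_proj (j : 'I_k) : 'M[K]_(dX, n) :=
  (\mxcol_(i < k) (if i == j then 1%:M else 0 : 'M[K]_n))%R.

Definition block_inj (j : 'I_k) : 'M[K]_(n, dX) :=
  (\mxrow_(i < k) (if i == j then 1%:M else 0 : 'M[K]_n))%R.

Lemma block_projE m (A : 'M[K]_(m, dX)) j : (A *m block_proj j = submxrow A j)%R.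
Proof.
rewrite -{1}(submxrowK A) mul_mxrow_mxcol (sum_only (i := j)) ?eqxx ?mulmx1 //.
by move=> i /negPf->; rewrite mulmx0.
Qed.

Lemma block_injE m (A : 'M[K]_(m, n)) j i :
  (submxrow (A *m block_inj j) i = if i == j then A else 0)%R.
Proof.
rewrite /block_inj mul_mxrow mxrowK.
by case: ifP; rewrite ?mulmx1 ?mulmx0.
Qed.

Lemma block_sum m (A : 'M[K]_(m, dX)) :
  A = (\sum_j A *m block_proj j *m block_inj j)%R.
Proof.
apply/mxrowP=> i; rewrite submxrow_sum (sum_only (i := i)) => [|j ji].
  by rewrite block_injE eqxx block_projE.
by rewrite block_injE eq_sym (negPf ji).
Qed.

Lemma base_coset : exists i0, rep i0 = 1.
Proof.
have [i0 iP] := rcoset_rep_exists P (group1 G); exists i0.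
have := iP i0; rewrite eqxx mul1g groupV => Pi0.
by rewrite /rcoset_rep -rcoset_repK // rcoset_id // repr_group.
Qed.

Definition base_index : 'I_k := sval (cid base_coset).
Local Notation i0 := base_index.

Lemma rep_base : rep i0 = 1.
Proof. by rewrite /base_index; case: cid. Qed.

(** In the function model [ind_proj] is evaluation at [1], evaluation at [g] is
    [rX g^-1 *m ind_proj], and [ind_inj] yields the functions supported on [P]. *)
Definition ind_proj := block_proj i0.
Definition ind_inj := block_inj i0.

Lemma ind_mx_proj x j : (ind_mx G rP x *m block_proj j =
  \mxcol_(i < k) (if (rep i * x * (rep j)^-1)%g \in P
     then rP (rep i * x * (rep j)^-1)%g else 0 : 'M[K]_n))%R.
Proof. by rewrite block_projE /ind_mx mxblockEh mxrowK. Qed.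

Lemma rep_mem i x : x \in P -> (rep i * x \in P) = (i == i0).
Proof.
have [j jP] := rcoset_rep_exists P (rcoset_rep_in sPG i).
have ij : i = j by apply/eqP; rewrite -jP mulgV group1.
by have := jP i0; rewrite rep_base invg1 mulg1 -ij eq_sym => <- Px; rewrite groupMr.
Qed.

Lemma ind_projP x : x \in P -> (rX x *m ind_proj = ind_proj *m rP x)%R.
Proof.
move=> Px; rewrite [LHS]ind_mx_proj /ind_proj /block_proj mxcol_mul.
apply: eq_mxcol => i; rewrite rep_base invg1 mulg1 rep_mem //.
by case: eqP => [->|_]; rewrite ?mul0mx // rep_base mul1g mul1mx.
Qed.

Lemma ind_proj_rep j : (rX (rep j)^-1%g *m ind_proj = block_proj j)%R.
Proof.
rewrite [LHS]ind_mx_proj; apply: eq_mxcol => i.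
rewrite rep_base invg1 mulg1.
have [l lP] := rcoset_rep_exists P (rcoset_rep_in sPG i).
have il : i = l by apply/eqP; rewrite -lP mulgV group1.
rewrite lP -il eq_sym; case: eqP => [->|//].
by rewrite mulgV repr_mx1.
Qed.

Lemma block_inj_mulE m (A : 'M[K]_(dX, m)) j : (block_inj j *m A = submxcol A j)%R.
Proof.
rewrite -{1}(submxcolK A) mul_mxrow_mxcol (sum_only (i := j)) ?eqxx ?mul1mx //.
by move=> i /negPf->; rewrite mul0mx.
Qed.

Lemma ind_mx_inj x j : (block_inj j *m ind_mx G rP x =
  \mxrow_(i < k) (if (rep j * x * (rep i)^-1)%g \in P
     then rP (rep j * x * (rep i)^-1)%g else 0 : 'M[K]_n))%R.
Proof. by rewrite block_inj_mulE /ind_mx mxblockEv mxcolK. Qed.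

Lemma ind_injP x : x \in P -> (ind_inj *m rX x = rP x *m ind_inj)%R.
Proof.
move=> Px; rewrite [LHS]ind_mx_inj /ind_inj /block_inj mul_mxrow.
apply: eq_mxrow => i; rewrite rep_base mul1g.
have -> : (x * (rep i)^-1 \in P) = (i == i0).
  by rewrite groupMl // groupV -[rep i]mulg1 rep_mem.
by case: eqP => [->|_]; rewrite ?mulmx0 // rep_base invg1 mulg1 mulmx1.
Qed.

Lemma ind_inj_rep j : (ind_inj *m rX (rep j) = block_inj j)%R.
Proof.
rewrite [LHS]ind_mx_inj; apply: eq_mxrow => i; rewrite rep_base mul1g.
have [l lP] := rcoset_rep_exists P (rcoset_rep_in sPG j).
have jl : j = l by apply/eqP; rewrite -lP mulgV group1.
rewrite lP -jl; case: eqP => [->|//].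
by rewrite mulgV repr_mx1.
Qed.

Lemma ind_separated m (A : 'M[K]_(m, dX)) :
  {in G, forall g, A *m rX g *m ind_proj = 0}%R -> A = 0%R.
Proof.
move=> A0; rewrite [A]block_sum; apply: big1 => j _.
by rewrite -ind_proj_rep mulmxA A0 ?mul0mx // groupV rcoset_rep_in.
Qed.

Lemma ind_supported m (A : 'M[K]_(m, dX)) :
    {in G, forall g, g \notin P -> A *m rX g *m ind_proj = 0}%R ->
  A = (A *m ind_proj *m ind_inj)%R.
Proof.
move=> A0; rewrite {1}[A]block_sum (sum_only (i := i0)) // => j ji.
rewrite -ind_proj_rep mulmxA A0 ?mul0mx // groupV ?rcoset_rep_in //.
by rewrite -[rep j]mulg1 rep_mem ?(negPf ji).
Qed.

Lemma ind_generated m (V : 'M[K]_(m, dX)) : mxmodule rX V -> (ind_inj <= V)%MS ->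
  ((1%:M)%R <= V)%MS.
Proof.
move=> modV sIV; rewrite (block_sum (1%:M)%R); apply: summx_sub => j _.
rewrite -mulmxA mulmx_sub // -ind_inj_rep mulmx_sub //.
rewrite (submx_trans (submxMr _ sIV)) // (mxmoduleP modV) //.
exact: rcoset_rep_in.
Qed.

End InducedModule.

(** * Irreducible modules, fixed points and inflation *)

Lemma irr_full (K : fieldType) (gT : finGroupType) (G : {group gT}) n
    (rG : mx_representation K G n) m (U : 'M[K]_(m, n)) :
  mx_irreducible rG -> mxmodule rG U -> U != 0%R -> ((1%:M)%R <= U)%MS.
Proof.
case/mx_irrP=> _ irr modU nzU; rewrite -(genmxE U) sub1mx irr //.
  by rewrite (eqmx_module _ (genmxE U)).
by rewrite -submx0 genmxE submx0.
Qed.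

(** The sum over [H] maps into the fixed points and acts on them as the invertible scalar [#|H|].
    Unlike fixed points, its vanishing is visibly preserved by transposition. *)
Lemma rfix_mx_eq0 (K : fieldType) (gT : finGroupType) (G H : {group gT}) n
    (rG : mx_representation K G n) : H \subset G -> (#|H|%:R != 0 :> K)%R ->
  (rfix_mx rG H == 0)%R = (\sum_(x in H) rG x == 0)%R.
Proof.
move=> sHG nzH; apply/eqP/eqP => [f0|s0].
  suff h : ((\sum_(x in H) rG x)%R <= rfix_mx rG H)%MS.
    by apply/eqP; rewrite -submx0; apply: submx_trans h _; rewrite f0 sub0mx.
  apply/rfix_mxP=> y Hy; rewrite mulmx_suml [RHS](reindex_inj (mulIg y)).
  apply: eq_big => [x|x Hx]; first by rewrite groupMr.
  by rewrite repr_mxM ?(subsetP sHG).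
have : (rfix_mx rG H *m (\sum_(x in H) rG x) = #|H|%:R *: rfix_mx rG H)%R.
  rewrite mulmx_sumr (eq_bigr (fun=> rfix_mx rG H)) => [|x Hx].
    by rewrite sumr_const scaler_nat.
  exact: rfix_mx_id.
by rewrite s0 mulmx0 => /esym/eqP; rewrite scaler_eq0 (negPf nzH) => /eqP.
Qed.

Lemma sum_eq_const (V : zmodType) (I : finType) (A : {pred I}) (F : I -> V) x :
  {in A, forall i, F i = x} -> (\sum_(i in A) F i = x *+ #|A|)%R.
Proof. by move=> Fx; rewrite (eq_bigr (fun=> x)) ?sumr_const. Qed.

Section Inflation.

Variables (K : fieldType) (gT : finGroupType) (A L P : {group gT}) (n : nat).
Hypothesis sdP : A ><| L = P.
Variable rL : mx_representation K L n.

Lemma infl_mx_id x : x \in L -> infl_mx A rL x = rL x.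
Proof.
have [_ _ _ _ tiAL] := sdprod_context sdP => Lx.
by rewrite /infl_mx remgr_id.
Qed.

Lemma infl_mx1 x : x \in A -> infl_mx A rL x = (1%:M)%R.
Proof. by move=> Ax; rewrite /infl_mx remgr1 ?repr_mx1. Qed.

End Inflation.

(** * Irreducibility of the induced module, given a nonzero map from [M1] to [M0] *)

Section CuspidalSubmodule.

Variables (K : fieldType) (gT : finGroupType) (A A' L L0 P Q G N V : {group gT}).
Hypotheses (sPG : P \subset G) (sdP : A ><| L = P) (sQL : Q \subset L)
  (sdQ : A' ><| L0 = Q).
Hypotheses (defV : A * A' = V) (nVL0 : L0 \subset 'N(V)) (sNG : N \subset G)
  (nzV : (#|V|%:R != 0 :> K)%R).
Hypothesis coverG : {in G, forall g, exists q n q',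
  [/\ q \in V * L0, n \in N, q' \in V * L0 & g = q * n * q']}.
Variables (n0 n1 : nat) (M0 : mx_representation K L0 n0)
  (M1 : mx_representation K L n1).
Hypotheses (irr0 : mx_irreducible M0) (irr1 : mx_irreducible M1).
Hypothesis cusp0 : {in N, forall n, n \in 'N(L0) \/ rfix_mx M0 (L0 :&: V :^ n) = 0%R}.
Hypothesis ramP : {in N, forall n (nLn : n \in 'N(L0)),
  mx_rsim (twist_repr M0 nLn) M0 -> n \in P}.
Variable pi : 'M[K]_(n1, n0).
Hypothesis nz_pi : pi != 0%R.
Hypothesis hom_pi : {in Q, forall x, (M1 x *m pi = pi *m infl_mx A' M0 x)%R}.

Local Notation rP := (infl_repr sdP M1).
Local Notation X := (ind_repr sPG rP).
Local Notation dX := (\sum_(i < #|rcosets P G|) n1)%N.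
Local Notation E := (ind_proj K P G n1).
Local Notation I := (ind_inj K P G n1).

Let sLP : L \subset P. Proof. by have /sdprod_context[] := sdP. Qed.
Let sAP : A \subset P. Proof. by have /sdprod_context[/andP[]] := sdP. Qed.
Let sL0Q : L0 \subset Q. Proof. by have /sdprod_context[] := sdQ. Qed.
Let sA'Q : A' \subset Q. Proof. by have /sdprod_context[/andP[]] := sdQ. Qed.
Let sL0L : L0 \subset L. Proof. exact: subset_trans sQL. Qed.
Let sL0P : L0 \subset P. Proof. exact: subset_trans sL0L sLP. Qed.
Let sL0G : L0 \subset G. Proof. exact: subset_trans sL0P sPG. Qed.
Let sVP : V \subset P.
Proof. by rewrite -defV mul_subG // (subset_trans sA'Q) ?(subset_trans sQL). Qed.
Let sVG : V \subset G. Proof. exact: subset_trans sVP sPG. Qed.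

(** [A] acts trivially on the inflation of [M1], and [A'] acts trivially on the target of [pi]. *)
Lemma radical_pi x : x \in V -> (rP x *m pi = pi)%R.
Proof.
rewrite -defV => /mulsgP[a a' Aa Aa' ->].
have [Pa Qa'] := (subsetP sAP a Aa, subsetP sA'Q a' Aa').
have La' := subsetP sQL a' Qa'.
rewrite repr_mxM ?(subsetP sLP a') // [rP a]infl_mx1 // mul1mx.
by rewrite [rP a'](infl_mx_id sdP) // hom_pi // infl_mx1 // mulmx1.
Qed.

Lemma levi_pi x : x \in L0 -> (rP x *m pi = pi *m M0 x)%R.
Proof.
move=> Lx; rewrite [rP x](infl_mx_id sdP) ?(subsetP sL0L) // hom_pi ?(subsetP sL0Q) //.
by rewrite (infl_mx_id sdQ).
Qed.

(** The vectors satisfying the condition form a submodule [Z] of [M1] inside the kernel of [pi], so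
    [Z] is zero by irreducibility. *)
Lemma pi_separated m (z : 'M_(m, n1)) :
  {in L, forall x, z *m M1 x *m pi = 0}%R -> z = 0%R.
Proof.
move=> z0; pose Z := (\bigcap_(x in L) kermx (M1 x *m pi))%MS.
have sZ : (z <= Z)%MS.
  by apply/sub_bigcapmxP=> x Lx; apply/sub_kermxP; rewrite mulmxA z0.
have modZ : mxmodule M1 Z.
  apply/mxmoduleP=> x Lx; apply/sub_bigcapmxP=> y Ly; apply/sub_kermxP.
  rewrite mulmxA -(mulmxA Z) -repr_mxM // -mulmxA; apply/sub_kermxP.
  by apply: (bigcapmx_inf (x * y)); rewrite ?groupM.
apply/eqP; apply: contraR nz_pi => nz; rewrite -submx0 -[pi]mul1mx.
have nzZ : Z != 0%R by apply: contra nz => /eqP Z0; rewrite Z0 in sZ; rewrite -submx0.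
rewrite (submx_trans (submxMr _ (irr_full irr1 modZ nzZ))) // submx0; apply/eqP/sub_kermxP.
rewrite -[pi]mul1mx -(repr_mx1 M1).
by apply: (bigcapmx_inf 1); rewrite ?group1.
Qed.

Let theta (n : gT) : 'M[K]_(dX, n0) := (X n^-1%g *m E *m pi)%R.

Lemma theta_hom n y : n \in N -> n \in 'N(L0) -> y \in L0 ->
  (X y *m theta n = theta n *m M0 (y ^ n^-1)%g)%R.
Proof.
move=> Nn nLn Ly; have Gn := subsetP sNG n Nn; have Gy := subsetP sL0G y Ly.
have Lyn : y ^ n^-1 \in L0 by rewrite memJ_norm ?groupV.
rewrite /theta -!mulmxA -levi_pi // (mulmxA E) -ind_projP ?(subsetP sL0P) //.
rewrite !mulmxA -!repr_mxM ?groupV ?(subsetP sL0G _ Lyn) //.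
by rewrite conjgE invgK !mulgA mulVg mul1g.
Qed.

Lemma theta1_hom y : y \in L0 -> (X y *m (E *m pi) = E *m pi *m M0 y)%R.
Proof.
move=> Ly; rewrite mulmxA ind_projP ?(subsetP sL0P) // -[LHS]mulmxA levi_pi //.
by rewrite mulmxA.
Qed.

(** The values of [theta n] on [V]-fixed vectors are fixed by [L0 :&: V :^ n^-1], and [cusp0] leaves
    no such vectors. *)
Lemma fixed_theta0 m (w : 'M_(m, dX)) n : (w <= rfix_mx X V)%MS -> n \in N ->
  n \notin 'N(L0) -> (w *m theta n = 0)%R.
Proof.
move=> fw Nn nLn; have Nn' : n^-1 \in N by rewrite groupV.
have [|f0] := cusp0 Nn'; first by rewrite groupV (negPf nLn).
apply/eqP; rewrite -submx0 -f0; apply/rfix_mxP=> y /setIP[Ly].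
rewrite mem_conjg invgK => Vyn; have Gn := subsetP sNG n Nn.
have Gy := subsetP sL0G y Ly; have Gyn : y ^ n \in G by rewrite groupJ.
rewrite /theta -!mulmxA -levi_pi // (mulmxA E) -ind_projP ?(subsetP sL0P) //.
rewrite !mulmxA -(mulmxA w _ (X y)) -repr_mxM ?groupV //.
have -> : n^-1 * y = y ^ n * n^-1 by rewrite conjgE !mulgA mulgK.
by rewrite repr_mxM ?groupV // mulmxA (rfix_mxP V fw).
Qed.

Lemma fixed_levi m (w : 'M_(m, dX)) y : (w <= rfix_mx X V)%MS -> y \in L0 ->
  ((w *m X y)%R <= rfix_mx X V)%MS.
Proof.
move=> fw Ly; apply/rfix_mxP=> v Vv.
have [Gy Gv] := (subsetP sL0G y Ly, subsetP sVG v Vv).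
have Vv' : v ^ y^-1 \in V by rewrite memJ_norm // groupV (subsetP nVL0).
have Gv' := subsetP sVG _ Vv'.
rewrite -mulmxA -repr_mxM //.
by rewrite conjgCV repr_mxM // mulmxA (rfix_mxP V fw).
Qed.

Section ProperSubmodule.

Variable U : 'M[K]_dX.
Hypotheses (modU : mxmodule X U) (nzU : U != 0%R) (properU : ~~ row_full U).

(** The vectors of [M1] whose extensions by zero lie in [U] form a submodule. If nonzero it is all
    of [M1], which generates [X], although [U] is proper. *)
Lemma inj_cap0 m (w : 'M_(m, n1)) : ((w *m I)%R <= U)%MS -> w = 0%R.
Proof.
pose Z := kermx (I *m cokermx U)%R.
have ZI : ((Z *m I)%R <= U)%MS by rewrite submxE -mulmxA mulmx_ker.
have modZ : mxmodule M1 Z.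
  apply/mxmoduleP=> x Lx; apply/sub_kermxP; rewrite mulmxA; apply/eqP.
  rewrite -submxE -mulmxA -(infl_mx_id sdP M1 Lx) -(ind_injP sPG rP) ?(subsetP sLP) //.
  rewrite mulmxA (submx_trans (submxMr _ ZI)) // (mxmoduleP modU) //.
  by rewrite (subsetP sPG) ?(subsetP sLP).
rewrite submxE -mulmxA => wI; have : (w <= Z)%MS by apply/sub_kermxP/eqP.
have [-> |nzZ] := eqVneq Z 0%R; first by rewrite submx0 => /eqP.
case/negP: properU; rewrite -sub1mx (@ind_generated _ _ _ _ _ sPG rP) //.
by rewrite -[I]mul1mx (submx_trans (submxMr _ (irr_full irr1 modZ nzZ))).
Qed.

Lemma proj_pi_neq0 : (U *m E *m pi != 0)%R.
Proof.
have modUE : mxmodule M1 (U *m E)%R.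
  apply/mxmoduleP=> x Lx; rewrite -(infl_mx_id sdP M1 Lx) -mulmxA.
  have Px := subsetP sLP x Lx.
  rewrite -(ind_projP sPG rP Px) mulmxA submxMr // (mxmoduleP modU) //.
  exact: (subsetP sPG).
have nzUE : (U *m E != 0)%R.
  apply: contra nzU => /eqP UE0; apply/eqP/(@ind_separated _ _ _ _ _ sPG rP) => g Gg.
  by have /submxP[C ->] := mxmoduleP modU g Gg; rewrite -mulmxA UE0 mulmx0.
apply: contra nz_pi => /eqP h; have /submxP[C C1] := irr_full irr1 modUE nzUE.
by rewrite -[pi]mul1mx C1 -!mulmxA (mulmxA U) h mulmx0.
Qed.

Local Notation F := (U :&: rfix_mx X V)%MS.

(** Summing over [V] maps [U] into its fixed points and multiplies the value under [E *m pi] by the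
    order of [V], since [V] acts trivially there. *)
Lemma fixed_pi_neq0 : (F *m (E *m pi) != 0)%R.
Proof.
apply: contra proj_pi_neq0 => /eqP F0.
pose e := (\sum_(v in V) X v)%R.
have sUF : ((U *m e)%R <= F)%MS.
  rewrite sub_capmx mulmx_sumr summx_sub => [|v Vv]; last first.
    by rewrite (mxmoduleP modU) // (subsetP sVG).
  apply/rfix_mxP=> y Vy; rewrite mulmx_suml [RHS](reindex_inj (mulIg y)).
  apply: eq_big => [x|x Vx]; first by rewrite groupMr.
  by rewrite repr_mxM ?(subsetP sVG) // mulmxA.
have : (U *m e *m (E *m pi) = 0)%R.
  by have /submxP[C ->] := sUF; rewrite -mulmxA F0 mulmx0.
rewrite mulmx_sumr mulmx_suml (sum_eq_const (x := (U *m E *m pi)%R)) => [|v Vv].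
  by rewrite -scaler_nat => /eqP; rewrite scaler_eq0 (negPf nzV).
by rewrite -!mulmxA (mulmxA _ E) ind_projP ?(subsetP sVP) // -mulmxA radical_pi.
Qed.

(** The hypothesis forces all values of [w] outside [P] to vanish, so [w] is supported on [P] and
    [inj_cap0] applies. *)
Lemma theta_separated m (w : 'M_(m, dX)) : (w <= F)%MS ->
  {in N, forall n, n \notin P -> w *m theta n = 0}%R -> w = 0%R.
Proof.
rewrite sub_capmx => /andP[wU fw] w0.
have w0' n y : n \in N -> n \notin P -> y \in L0 -> (w *m X y *m theta n = 0)%R.
  move=> Nn nPn Ly; have [nLn|nLn] := boolP (n \in 'N(L0)).
    by rewrite -mulmxA theta_hom // mulmxA w0 // mul0mx.
  by rewrite fixed_theta0 // fixed_levi.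
have wE0 : {in G, forall g, g \notin P -> w *m X g *m E = 0}%R.
  move=> g Gg nPg; apply: pi_separated => x Lx.
  have Px := subsetP sLP x Lx; have Gx := subsetP sPG x Px.
  rewrite -(infl_mx_id sdP M1 Lx) -(mulmxA _ E) -(ind_projP sPG rP Px) mulmxA.
  rewrite -(mulmxA w _ (X x)) -repr_mxM //.
  have nPgx : g * x \notin P by rewrite groupMr.
  (* With [q = v * y] and [q' = v' * y'], the factor [v] fixes [w], [y] preserves the fixed points,
     [radical_pi] removes [v'], and [y'] passes through [pi]. What remains is [theta n^-1]. *)
  have [q [n [q' [VLq Nn VLq' gxE]]]] := coverG (groupM Gg Gx).
  case/mulsgP: VLq => v y Vv Ly qE; case/mulsgP: VLq' => v' y' Vv' Ly' q'E.
  have Pq : q \in P by rewrite qE groupM ?(subsetP sVP v) ?(subsetP sL0P y).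
  have Pq' : q' \in P by rewrite q'E groupM ?(subsetP sVP v') ?(subsetP sL0P y').
  have nPn : n^-1 \notin P.
    by rewrite groupV; apply: contra nPgx => Pn; rewrite gxE !groupM.
  have [Gv Gy] := (subsetP sVG v Vv, subsetP sL0G y Ly).
  have [Gn Gq'] := (subsetP sNG n Nn, subsetP sPG q' Pq').
  rewrite gxE qE 3?repr_mxM ?groupM // !mulmxA.
  rewrite (rfix_mxP V fw) // -(mulmxA _ _ E) (ind_projP sPG rP) //.
  rewrite q'E repr_mxM ?(subsetP sVP v') ?(subsetP sL0P y') // -!mulmxA levi_pi //.
  rewrite (mulmxA _ pi) radical_pi //.
  have := w0' n^-1 y; rewrite groupV /theta invgK => /(_ Nn nPn Ly) e.
  by rewrite !mulmxA in e *; rewrite e mul0mx.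
have wE := ind_supported wE0.
by rewrite wE (inj_cap0 (w := (w *m E)%R)) ?mul0mx // -wE.
Qed.

(** On [Y] the kernel of [theta n] lies in that of [E *m pi], so the latter factors through the
    former by a nonzero endomorphism of the space of [M0], which intertwines the twist with [M0] and
    is invertible by irreducibility. *)
Lemma theta_iso (Y : 'M[K]_dX) n : {in L0, forall y, ((Y *m X y)%R <= Y)%MS} ->
    n \in N -> forall nLn : n \in 'N(L0), (Y *m theta n != 0)%R ->
    (Y *m (E *m pi) != 0)%R ->
    (forall m (w : 'M_(m, dX)), (w <= Y)%MS -> w *m theta n = 0 ->
       w *m (E *m pi) = 0)%R ->
  mx_rsim (twist_repr M0 nLn) M0.
Proof.
move=> stY Nn nLn nzt nz1 kert.
have modt : mxmodule M0 (Y *m theta n)%R.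
  apply/mxmoduleP=> y Ly; have Lyn : y ^ n \in L0 by rewrite memJ_norm.
  by rewrite -mulmxA -[y](conjgK n) -theta_hom // mulmxA submxMr ?stY.
have /submxP[C C1] := irr_full irr0 modt nzt.
(* [C *m Y] is a section of [theta n]; it need not commute with [L0], but [kert] absorbs the
   defect. *)
pose Z := (C *m Y *m (E *m pi))%R.
have YZ : (Y *m theta n *m Z = Y *m (E *m pi))%R.
  have k0 : ((Y *m theta n *m C *m Y - Y) *m (E *m pi) = 0)%R.
    apply: kert; first by rewrite addmx_sub ?eqmx_opp // mulmx_sub.
    by rewrite mulmxBl -(mulmxA _ Y) -(mulmxA _ C) -C1 mulmx1 subrr.
  by apply/eqP; rewrite -subr_eq0 -[X in _ == X]k0 mulmxBl /Z !mulmxA.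
have hZ y : y \in L0 -> (M0 (y ^ n^-1)%g *m Z = Z *m M0 y)%R.
  move=> Ly; have k0 :
    ((M0 (y ^ n^-1)%g *m C *m Y - C *m Y *m X y) *m (E *m pi) = 0)%R.
    apply: kert.
      by rewrite addmx_sub ?mulmx_sub // eqmx_opp -mulmxA mulmx_sub ?stY.
    rewrite mulmxBl -(mulmxA _ (X y)) theta_hom // (mulmxA _ (theta n)).
    by rewrite -!(mulmxA _ Y (theta n)) -(mulmxA _ C) -C1 mulmx1 mul1mx subrr.
  apply/eqP; rewrite -subr_eq0 /Z -[(C *m Y *m _ *m M0 y)%R]mulmxA -theta1_hom //.
  by rewrite -[X in _ == X]k0 mulmxBl !mulmxA.
have nzZ : Z != 0%R by apply: contra nz1 => /eqP Z0; rewrite -YZ Z0 mulmx0.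
have modZ : mxmodule M0 Z.
  by apply/mxmoduleP=> y Ly; rewrite -hZ // submxMl.
have := irr_full irr0 modZ nzZ; rewrite sub1mx row_full_unit -row_free_unit => fZ.
by exists Z => // y Ly; apply: hZ.
Qed.

(* The first n in s for which theta_1 vanishes on the common kernel of the
   theta's up to n gives the isomorphism. *)
Lemma theta_chain (s : seq gT) (Y : 'M[K]_dX) : {subset s <= N} -> (Y <= F)%MS ->
    {in L0, forall y, ((Y *m X y)%R <= Y)%MS} -> (Y *m (E *m pi) != 0)%R ->
    (forall m (w : 'M_(m, dX)), (w <= Y)%MS ->
       {in s, forall n, w *m theta n = 0} -> w = 0)%R ->
  exists2 n, n \in s & exists nLn : n \in 'N(L0), mx_rsim (twist_repr M0 nLn) M0.
Proof.
elim: s Y => [|n s IHs] Y sN sYF stY nz1 sep.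
  by case/eqP: nz1; rewrite (sep _ Y) ?mul0mx.
have Nn : n \in N by rewrite sN ?mem_head.
have sN' : {subset s <= N} by move=> x sx; rewrite sN // inE sx orbT.
have lift (Y' : 'M[K]_dX) : (Y' <= F)%MS -> {in L0, forall y, ((Y' *m X y)%R <= Y')%MS} ->
    (Y' *m (E *m pi) != 0)%R ->
    (forall m (w : 'M_(m, dX)), (w <= Y')%MS ->
       {in s, forall n, w *m theta n = 0} -> w = 0)%R ->
    exists2 x, x \in n :: s &
      exists nLn : x \in 'N(L0), mx_rsim (twist_repr M0 nLn) M0.
  move=> sY' stY' nzY' sepY'; have [x sx hx] := IHs Y' sN' sY' stY' nzY' sepY'.
  by exists x; rewrite // inE sx orbT.
have [t0|nzt] := eqVneq (Y *m theta n)%R 0%R.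
  apply: (lift Y) => // m w sw w0; apply: sep => // x; rewrite inE.
  case/predU1P=> [->|]; last exact: w0.
  by have /submxP[C ->] := sw; rewrite -mulmxA t0 mulmx0.
have nLn : n \in 'N(L0).
  apply: contraR nzt => nLn; apply/eqP/fixed_theta0 => //.
  by apply: submx_trans sYF (capmxSr _ _).
pose Y' := (Y :&: kermx (theta n))%MS.
have [Y'0|nzY'] := eqVneq (Y' *m (E *m pi))%R 0%R.
  exists n; rewrite ?mem_head //; exists nLn; apply: (theta_iso stY) => // m w sw w0.
  have /submxP[C ->] : (w <= Y')%MS by rewrite sub_capmx sw; apply/sub_kermxP.
  by rewrite -mulmxA Y'0 mulmx0.
apply: (lift Y') => //.
- exact: submx_trans (capmxSl _ _) sYF.
- move=> y Ly; rewrite sub_capmx (submx_trans (submxMr _ (capmxSl _ _))) ?stY //.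
  apply/sub_kermxP; rewrite -mulmxA theta_hom // mulmxA.
  by rewrite (sub_kermxP (capmxSr Y _)) mul0mx.
move=> m w; rewrite sub_capmx => /andP[swY /sub_kermxP wn] w0; apply: sep => // x.
by rewrite inE => /predU1P[->|] //; apply: w0.
Qed.

Lemma proper_submodule_absurd : False.
Proof.
(* The list consists of the elements of [N] outside [P], so the isomorphism obtained contradicts
   [ramP]. *)
have [|||||n] := @theta_chain (enum (N :\: P)) F.
- by move=> n; rewrite mem_enum => /setDP[].
- exact: submx_refl.
- move=> y Ly; rewrite sub_capmx fixed_levi ?capmxSr // andbT.
  rewrite (submx_trans (submxMr _ (capmxSl _ _))) // (mxmoduleP modU) //.
  exact: (subsetP sL0G).
- exact: fixed_pi_neq0.
- move=> m w sw w0; apply: theta_separated => // n Nn nPn.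
  by apply: w0; rewrite mem_enum inE nPn.
rewrite mem_enum => /setDP[Nn nPn] [nLn /(ramP Nn)].
by rewrite (negPf nPn).
Qed.

End ProperSubmodule.

Lemma ind_irreducible : mx_irreducible X.
Proof.
apply/mx_irrP; split=> [|U modU nzU].
  rewrite sum_nat_const card_ord muln_gt0 indexg_gt0.
  by have /mx_irrP[] := irr1.
by apply: contraT => /(proper_submodule_absurd modU nzU).
Qed.

End CuspidalSubmodule.

(** * Contragredient modules *)

Section Contragredient.

Variables (K : fieldType) (gT : finGroupType).

(** A symmetric relation instead of an operation: inflation and induction respect it by equality of
    matrices, without any change of basis. *)
Definition contragredient (G : {group gT}) n (r1 r2 : mx_representation K G n) : Prop :=
  {in G, forall x, r2 x = (r1 x^-1%g)^T}%R.

Definition dual_mx (G : {group gT}) n (rG : mx_representation K G n) (x : gT) :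
  'M[K]_n := ((rG x^-1%g)^T)%R.

Lemma dual_mx_repr (G : {group gT}) n (rG : mx_representation K G n) :
  mx_repr G (dual_mx rG).
Proof.
split=> [|x y Gx Gy]; first by rewrite /dual_mx invg1 repr_mx1 trmx1.
by rewrite /dual_mx invMg repr_mxM ?groupV // trmx_mul.
Qed.

Definition dual_repr (G : {group gT}) n (rG : mx_representation K G n) :=
  MxRepresentation (dual_mx_repr rG).

Lemma dual_contragredient (G : {group gT}) n (rG : mx_representation K G n) :
  contragredient rG (dual_repr rG).
Proof. by []. Qed.

Lemma contragredient_sym (G : {group gT}) n (r1 r2 : mx_representation K G n) :
  contragredient r1 r2 -> contragredient r2 r1.
Proof. by move=> r12 x Gx; rewrite r12 ?groupV // invgK trmxK. Qed.

(** The annihilator of a submodule for [r2] is a submodule for [r1]. *)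
Lemma contragredient_irr (G : {group gT}) n (r1 r2 : mx_representation K G n) :
  contragredient r1 r2 -> mx_irreducible r1 -> mx_irreducible r2.
Proof.
move=> r12 irr1; have [n_gt0 _] := (mx_irrP r1).1 irr1.
apply/mx_irrP; split=> // U modU nzU.
have modZ : mxmodule r1 (kermx U^T)%R.
  apply/mxmoduleP=> x Gx; apply/sub_kermxP.
  have Gx' : x^-1 \in G by rewrite groupV.
  have /submxP[C UC] := mxmoduleP modU _ Gx'.
  rewrite -mulmxA -[r1 x]trmxK -trmx_mul -[x in r1 x]invgK -r12 // UC.
  by rewrite trmx_mul mulmxA mulmx_ker mul0mx.
have [Z0|nzZ] := eqVneq (kermx U^T)%R 0%R.
  by move/eqP: Z0; rewrite kermx_eq0 /row_free /row_full mxrank_tr.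
case/eqP: nzU; apply: trmx_inj; rewrite trmx0 -[(U^T)%R]mul1mx.
by apply/sub_kermxP; apply: irr_full irr1 modZ nzZ.
Qed.

Lemma contragredient_rfix (G H : {group gT}) n (r1 r2 : mx_representation K G n) :
    contragredient r1 r2 -> H \subset G -> (#|H|%:R != 0 :> K)%R ->
  rfix_mx r1 H = 0%R -> rfix_mx r2 H = 0%R.
Proof.
move=> r12 sHG nzH /eqP f0; apply/eqP; move: f0.
rewrite !rfix_mx_eq0 // => /eqP s0; rewrite (reindex_inj invg_inj) /=.
rewrite (eq_big (fun x => x \in H) (fun x => (r1 x)^T)%R) => [|x|x].
- by rewrite -linear_sum s0 linear0.
- by rewrite groupV.
by move=> Hx; rewrite r12 ?invgK // (subsetP sHG).
Qed.

Lemma contragredient_twist (L : {group gT}) n (r1 r2 : mx_representation K L n) x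
    (nLx : x \in 'N(L)) : contragredient r1 r2 ->
  mx_rsim (twist_repr r2 nLx) r2 -> mx_rsim (twist_repr r1 nLx) r1.
Proof.
move=> r12 [C _ fC homC]; apply: mx_rsim_sym; exists (C^T)%R => // [|y Ly].
  by rewrite /row_free mxrank_tr.
have Ly' : y^-1 \in L by rewrite groupV.
have := congr1 trmx (homC _ Ly'); rewrite !trmx_mul [twist_repr _ _ _]r12; last first.
  by rewrite memJ_norm ?groupV.
by rewrite r12 // !trmxK conjVg !invgK.
Qed.

Lemma contragredient_infl (U L P : {group gT}) (sdP : U ><| L = P) n
    (r1 r2 : mx_representation K L n) :
  contragredient r1 r2 -> contragredient (infl_repr sdP r1) (infl_repr sdP r2).
Proof.
move=> r12 x Px; have [nsUP _ defP _ tiUL] := sdprod_context sdP.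
have cL : L \in [complements to U in P] by apply/complP; split.
have memL y : y \in P -> remgr U L y \in L by rewrite -defP; apply: mem_remgr.
rewrite /= /infl_mx r12 ?memL //; congr (r1 _)^T%R; apply/eqP; rewrite eq_invg_mul.
by rewrite -(remgrM cL) ?groupV // mulgV remgr1.
Qed.

Lemma contragredient_ind (P G : {group gT}) (sPG : P \subset G) n
    (r1 r2 : mx_representation K P n) :
  contragredient r1 r2 -> contragredient (ind_repr sPG r1) (ind_repr sPG r2).
Proof.
move=> r12 x Gx; rewrite /= /ind_mx tr_mxblock; apply: eq_mxblock => i j.
have e : rcoset_rep j * x^-1 * (rcoset_rep i)^-1 =
    (rcoset_rep i * x * (rcoset_rep j)^-1)^-1 :> gT.
  by rewrite !invMg invgK mulgA.
rewrite e groupV; case: ifP => [Px|_]; last by rewrite trmx0.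
by rewrite r12.
Qed.

End Contragredient.

(** * Maps obtained from submodules and quotients of an induced module *)

Section HomsFromInduced.

Variables (K : fieldType) (gT : finGroupType) (Q L : {group gT}) (sQL : Q \subset L).
Variables (n0 n1 : nat) (rQ : mx_representation K Q n0)
  (M1 : mx_representation K L n1).
Hypothesis irr1 : mx_irreducible M1.

Local Notation X := (ind_repr sQL rQ).

(** Compose the embedding with evaluation at [1]; if the composite vanished, all values of the
    embedded functions would vanish. *)
Lemma submod_ind_hom V (modV : mxmodule X V) : mx_rsim M1 (submod_repr modV) ->
  exists2 pi : 'M[K]_(n1, n0), pi != 0%R & {in Q, forall x, M1 x *m pi = pi *m rQ x}%R.
Proof.
case=> C _ fC homC; have [n1_gt0 _] := (mx_irrP M1).1 irr1.
pose phi := val_submod C.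
have homphi x : x \in L -> (M1 x *m phi = phi *m X x)%R.
  move=> Lx; rewrite -(val_submodJ modV) // -homC //.
  by rewrite /phi val_submodE mulmxA -val_submodE.
exists (phi *m ind_proj K Q L n0)%R => [|x Qx]; last first.
  by rewrite mulmxA homphi ?(subsetP sQL) // -!mulmxA ind_projP.
apply/eqP=> pi0; have /eqP : phi = 0%R.
  apply: (ind_separated (sPG := sQL) (rP := rQ)) => g Lg.
  by rewrite -homphi // -mulmxA pi0 mulmx0.
rewrite val_submod_eq0 => /eqP C0; move: fC.
by rewrite C0 /row_free mxrank0 eq_sym -leqn0 leqNgt n1_gt0.
Qed.

(** Compose the inclusion of functions supported on [Q] with the quotient map; these functions
    generate the induced module, so the composite is nonzero. *)
Lemma factmod_ind_hom V (modV : mxmodule X V) : mx_rsim M1 (factmod_repr modV) ->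
  exists2 io : 'M[K]_(n0, n1), io != 0%R & {in Q, forall x, rQ x *m io = io *m M1 x}%R.
Proof.
case/mx_rsim_sym=> C eqn fC homC; have [n1_gt0 _] := (mx_irrP M1).1 irr1.
pose psi := (in_factmod V 1%:M *m C)%R.
have hompsi x : x \in L -> (X x *m psi = psi *m M1 x)%R.
  move=> Lx; rewrite /psi -[in RHS]mulmxA -homC // [in RHS]mulmxA -(in_factmodJ modV) //.
  by rewrite mul1mx mulmxA -in_factmodE.
exists (ind_inj K Q L n0 *m psi)%R => [|x Qx]; last first.
  by rewrite mulmxA -(ind_injP sQL) // -[LHS]mulmxA hompsi ?(subsetP sQL) // mulmxA.
apply/eqP=> io0; have modZ : mxmodule X (kermx psi).
  apply/mxmoduleP=> x Lx; apply/sub_kermxP.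
  by rewrite -mulmxA hompsi // mulmxA mulmx_ker mul0mx.
have := ind_generated modZ; rewrite (introT sub_kermxP io0) => /(_ isT).
move/sub_kermxP; rewrite mul1mx => /eqP; rewrite mulmx_free_eq0 //.
rewrite in_factmod_eq0 sub1mx /row_full => /eqP rV.
by move: eqn n1_gt0; rewrite mxrank_coker rV subnn => <-.
Qed.

End HomsFromInduced.

(** * Application to Harish-Chandra induction *)

Section HarishChandra.

Variables (gT : finGroupType) (G : {group gT}) (p : nat) (D : split_BN_pair p G).
Variables (R : realType) (Phi : root_system R D).
Hypothesis hcomm : commutator_relations Phi.
Variable K : fieldType.
Hypothesis hK : p \notin [pchar K]%R.
Variables (L0 L P Q : {group gT}).
Hypotheses (hL0 : is_levi Phi L0) (hL : is_levi Phi L) (hP : is_parabolic D P)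
  (hQ : is_parabolic_in Phi L Q).
Hypotheses (sPG : P \subset G) (sdP : 'O_p(P) ><| L = P).
Hypotheses (sQL : Q \subset L) (sdQ : 'O_p(Q) ><| L0 = Q).
Variables (n0 n1 : nat).

Lemma pgroup_natf_neq0 (V : {group gT}) : p.-group V -> (#|V|%:R != 0 :> K)%R.
Proof.
move=> pV; rewrite (card_pgroup pV) natrX expf_neq0 //; apply: contra hK => p0.
by rewrite inE /= (bn_prime D).
Qed.

Lemma HC_ind_irreducible (M0 : mx_representation K L0 n0)
    (M1 : mx_representation K L n1) (pi : 'M[K]_(n1, n0)) :
    mx_irreducible M0 -> mx_irreducible M1 ->
    (forall Q1 : {group gT}, is_parabolic_in Phi L0 Q1 -> Q1 \proper L0 ->
       rfix_mx M0 'O_p(Q1) = 0%R) ->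
    {in bnN D, forall n (nLn : n \in 'N(L0)),
       mx_rsim (twist_repr M0 nLn) M0 -> n \in P} ->
    pi != 0%R -> {in Q, forall x, M1 x *m pi = pi *m infl_repr sdQ M0 x}%R ->
  mx_irreducible (HC_ind sPG sdP M1).
Proof.
move=> irr0 irr1 cusp0 ramP nzpi hompi.
have [V [defV pV nVL0 [k Nk sBV] dich]] := levi_radical hcomm hL0 hL hP hQ sdP sdQ.
apply: (ind_irreducible sPG sdP sQL sdQ defV nVL0 (sNG D) _ _ irr0 irr1 _ _ nzpi) => //.
- exact: pgroup_natf_neq0.
(* Conjugating the Bruhat decomposition of [g ^ k^-1] by [k] gives the required one, since [B :^ k]
   lies in [V * L0]. *)
- move=> g Gg; have Gk := subsetP (sNG D) k Nk.
  have Ggk : g ^ k^-1 \in G by rewrite groupJ ?groupV.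
  have [w _ /cellP[b [n [c [Bb Nn Bc _ gE]]]]] := cell_cover D Ggk.
  exists (b ^ k), (n ^ k), (c ^ k); rewrite groupJ //.
  split=> //; first by rewrite (subsetP sBV) ?memJ_conjg.
    by rewrite (subsetP sBV) ?memJ_conjg.
  by rewrite -!conjMg -gE conjgKV.
move=> n Nn; have [nLn|[Q1 [hQ1 ltQ1 sOV]]] := dich n Nn; [by left | right].
apply/eqP; rewrite -submx0 -(cusp0 Q1 hQ1 ltQ1); apply: rfix_mxS.
by rewrite subsetI sOV (subset_trans (pcore_sub _ _) (proper_sub ltQ1)).
Qed.

End HarishChandra.

Theorem theorem7p2 (gT : finGroupType) (G : {group gT}) (p : nat)
    (D : split_BN_pair p G)
    (R : realType) (Phi : root_system R D) (hcomm : commutator_relations Phi)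
    (K : closedFieldType) (hK : p \notin [pchar K]%R)
    (* the Levi subgroup L0 and the cuspidal irreducible K L0-module M0 *)
    (L0 : {group gT}) (hL0 : is_levi Phi L0)
    (n0 : nat) (M0 : mx_representation K L0 n0)
    (hM0 : mx_irreducible M0) (hcusp : cuspidal Phi M0)
    (* the Levi subgroup L containing L0 *)
    (L : {group gT}) (hL : is_levi Phi L) (hL0L : L0 \subset L)
    (hW : ram_group M0 G (bnN D) = ram_group M0 L (bnN D :&: L))
    (* a parabolic subgroup P of G with Levi complement L *)
    (P : {group gT}) (hP : is_parabolic D P) (sPG : P \subset G)
    (sdP : 'O_p(P) ><| L = P)
    (* a parabolic subgroup Q of L with Levi complement L0 *)
    (Q : {group gT}) (hQ : is_parabolic_in Phi L Q) (sQL : Q \subset L)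
    (sdQ : 'O_p(Q) ><| L0 = Q)
    (* an irreducible submodule or quotient M1 of R_{L0}^L(M0) *)
    (n1 : nat) (M1 : mx_representation K L n1) (hM1 : mx_irreducible M1)
    (hM1X : sub_or_quotient M1 (HC_ind sQL sdQ M0)) :
  mx_irreducible (HC_ind sPG sdP M1).
Proof.
(* An element of [N] stabilizing [M0] gives an element of the ramification group of [G], hence by
   [hW] of that of [L]; since [L0] is contained in [L], it lies in [L] and so in [P]. *)
have ramP : {in bnN D, forall n (nLn : n \in 'N(L0)),
    mx_rsim (twist_repr M0 nLn) M0 -> n \in P}.
  move=> n Nn nLn iso; have [_ sLP _ _ _] := sdprod_context sdP.
  apply: (subsetP sLP); have Gn := subsetP (sNG D) n Nn.
  have : coset L0 n \in ram_group M0 G (bnN D).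
    apply: mem_morphim => //; rewrite -[n]mulg1 mem_mulg //.
    rewrite inE Nn andbT inE; apply/andP; split; first by rewrite inE Gn.
    by apply/asboolP; exists nLn.
  rewrite hW => /morphimP[y nLy /mulsgP[a b /setIP[_ /setIP[_ La]] L0b yE]].
  move/(rcoset_kercosetP nLn nLy)/rcosetP=> [c L0c ->].
  by rewrite yE !groupM // (subsetP hL0L).
case: hM1X => V [modV [sub|quo]].
  have [pi nz_pi hom_pi] := submod_ind_hom hM1 sub.
  exact: (HC_ind_irreducible hcomm hK hL0 hL hP hQ sPG sdP sQL
    hM0 hM1 hcusp ramP nz_pi hom_pi).
(* For a quotient the map goes from [M0] to [M1]. Its transpose goes from the dual of [M1] to the
   dual of [M0], so the submodule argument applies to the duals. *)
have [io nz_io hom_io] := factmod_ind_hom hM1 quo.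
have [dual0 dual1] := (dual_contragredient M0, dual_contragredient M1).
apply: contragredient_irr (contragredient_sym
  (contragredient_ind sPG (contragredient_infl sdP dual1))) _.
apply: (HC_ind_irreducible hcomm hK hL0 hL hP hQ sPG sdP sQL (M0 := dual_repr M0)
  (pi := (io^T)%R)).
- exact: contragredient_irr dual0 hM0.
- exact: contragredient_irr dual1 hM1.
- move=> Q1 hQ1 ltQ1; apply: contragredient_rfix dual0 _ _ (hcusp Q1 hQ1 ltQ1).
    by rewrite (subset_trans (pcore_sub _ _)) ?proper_sub.
  exact: (pgroup_natf_neq0 D hK (pcore_pgroup _ _)).
- by move=> n Nn nLn /(contragredient_twist dual0); apply: ramP.
- by apply: contra nz_io => /eqP io0; rewrite -[io]trmxK io0 trmx0.
move=> x Qx; have Qx' : x^-1 \in Q by rewrite groupV.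
rewrite (contragredient_infl sdQ dual0) // dual1 ?(subsetP sQL) //.
by rewrite -!trmx_mul hom_io.
Qed.
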